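(* For every $\epsilon\in(0,1/2]$ there exist constants $C_\epsilon>0$ and $C>0$ depending only on $\epsilon$ such that the following holds for all $n,T\ge2$, all $\omega_n>0$ and all $\alpha,\beta\in(0,1)$. Let $$H_{\alpha,n,T}=2\sqrt2(1+\epsilon)\sqrt{\omega_n}+C_\epsilon\log\Bigl(\frac{4n\log_2(T)}{\alpha}\Bigr),\qquad \psi_{n,T}(Y)=\mathbf 1_{\{\max_{t\in\mathcal T}\|Z_T(t)\|_{2\to2}>H_{\alpha,n,T}\}},$$ where $\mathcal T$ is the dyadic grid of $\{1,\dots,T-1\}$. If $$\mathcal R_{n,\mathcal D_T}\ \ge\ 4(1+\epsilon)\Bigl(\frac{6\,\omega_n}{T}\Bigr)^{1/2}+\frac{C}{\sqrt T}\log\Bigl(\frac{4n\log_2(T)}{\alpha\wedge\beta}\Bigr),$$ then $\alpha(\psi_{n,T})\le\alpha$ and $\beta(\psi_{n,T},\mathcal R_{n,\mathcal D_T})\le\beta$.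
   Context: Notation: $\|M\|_{2\to2}$ is the operator (spectral) norm of a matrix, $\|M\|_{1,\infty}=\max_j\sum_i|M_{ij}|$, $\odot$ is the entrywise (Hadamard) product, $q(t)=\sqrt{t(1-t)}$ for $t\in[0,1]$, $a\wedge b=\min(a,b)$. Parameter sets: $\mathcal C_n$ is the set of symmetric matrices in $[0,1]^{n\times n}$; $\mathcal C_n^0$ is the subset of those with zero diagonal; for $\omega_n>0$, $\mathcal S_n(\omega_n)=\{(\Theta,\Pi)\in\mathcal C_n^0\times\mathcal C_n:\ \|\Pi\odot\Theta\|_{1,\infty}\le\omega_n\}$. Throughout, sampling matrices $\Pi$ satisfy $\Pi_{ii}=1$ and $\Pi_{ij}>0$. Model: $Y^t\sim\mathrm{IRGML}(\Theta^t,\Pi)$ means that $Y^t$ is the symmetric $\{0,1\}$-valued $n\times n$ matrix with zero diagonal and $Y^t_{ij}=\Omega^t_{ij}A^t_{ij}$, where for $i<j$ the variables $A^t_{ij}\sim\mathrm{Bernoulli}(\Theta^t_{ij})$ and $\Omega^t_{ij}\sim\mathrm{Bernoulli}(\Pi_{ij})$ are all mutually independent. One observes $Y=(Y^1,\dots,Y^T)$, independent over $t$. Matrix CUSUM statistic: for $t=1,\dots,T-1$, $$Z_T(t)=\sqrt{\frac{t(T-t)}T}\Bigl(\frac1t\sum_{s=1}^tY^s-\frac1{T-t}\sum_{s=t+1}^TY^s\Bigr).$$ Dyadic grid: $\mathcal T=\{2^k:\ 0\le k\le\lfloor\log_2(T/2)\rfloor\}\cup\{T-2^k:\ 0\le k\le\lfloor\log_2(T/2)\rfloor\}$.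 Hypotheses and errors (problem of testing for a change at an unknown location in $\mathcal D_T=\{1,\dots,T-1\}$): $\mathrm P_{(\Theta^0,\Pi)}$ is the law of $Y$ when $\Theta^t=\Theta^0$ for all $t$. $\mathrm P^\tau_{\Theta^a,\Theta^b,\Pi}$ is the law of $Y$ when $\Theta^t=\Theta^a$ for $t\le\tau$ and $\Theta^t=\Theta^b$ for $t>\tau$. For $r>0$, $\mathcal W^\tau_{n,T}(\omega_n,r)$ is the set of all $\{(\Theta^a,\Pi),(\Theta^b,\Pi)\}$ with both pairs in $\mathcal S_n(\omega_n)$ and $q(\tau/T)\|\Pi\odot(\Theta^a-\Theta^b)\|_{2\to2}\ge r$. For a test $\psi$ (a measurable $\{0,1\}$-valued function of $Y$), $\alpha(\psi)=\sup_{(\Theta^0,\Pi)\in\mathcal S_n(\omega_n)}\mathrm P_{(\Theta^0,\Pi)}\{\psi=1\}$ and $\beta(\psi,r)=\sup_{\tau\in\mathcal D_T}\ \sup_{\{(\Theta^a,\Pi),(\Theta^b,\Pi)\}\in\mathcal W^\tau_{n,T}(\omega_n,r)}\mathrm P^\tau_{\Theta^a,\Theta^b,\Pi}\{\psi=0\}$. *)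

(* Defs.v *)
From HB Require Import structures.
From mathcomp Require Import all_boot all_order all_algebra.
From mathcomp Require Import all_classical all_reals all_analysis.

Set Implicit Arguments.
Unset Strict Implicit.
Unset Printing Implicit Defensive.

Import Order.TTheory GRing.Theory Num.Theory.

Local Open Scope classical_set_scope.
Local Open Scope ring_scope.

Definition log2 {R : realType} (x : R) : R := ln x / ln 2.

Definition q {R : realType} (t : R) : R := Num.sqrt (t * (1 - t)).

Definition enorm {R : realType} n (v : 'cV[R]_n) : R :=
  Num.sqrt (\sum_i v i ord0 ^+ 2).

Definition opnorm {R : realType} n (M : 'M[R]_n) : R :=
  sup [set enorm (M *m v) | v in [set v : 'cV[R]_n | enorm v <= 1]].

Definition norm1oo {R : realType} n (M : 'M[R]_n) : R :=
  \big[Num.max/0]_(j < n) \sum_(i < n) `|M i j|.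

Definition hadamard {R : realType} n (A B : 'M[R]_n) : 'M[R]_n :=
  map2_mx *%R A B.

Definition Cn {R : realType} n : set 'M[R]_n :=
  [set M | M^T = M /\ forall i j, 0 <= M i j <= 1].

Definition Cn0 {R : realType} n : set 'M[R]_n :=
  [set M | Cn M /\ forall i, M i i = 0].

Definition sampling_mx {R : realType} n (Pi : 'M[R]_n) : Prop :=
  (forall i, Pi i i = 1) /\ (forall i j, 0 < Pi i j).

(* The last conjunct is the standing assumption made on all sampling
   matrices. *)
Definition Sn {R : realType} n (omega : R) : set ('M[R]_n * 'M[R]_n) :=
  [set x | [/\ Cn0 x.1, Cn x.2, norm1oo (hadamard x.2 x.1) <= omega
             & sampling_mx x.2]].

Definition edge n := {e : 'I_n * 'I_n | (e.1 < e.2)%N}.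

(* Times 1, ..., T are represented by the ordinals 0, ..., T - 1: the ordinal s
   stands for time s + 1, so that "time <= t" reads s < t.  The coordinate
   (s, e) of a sample point is the pair (A, Omega) of edge e at time s + 1. *)
Definition sample n T := {ffun 'I_T * edge n -> bool * bool}.

(* Joint mass function of the mutually independent variables
   A^t_ij ~ Bernoulli(Theta^t_ij) and Omega^t_ij ~ Bernoulli(Pi_ij), i < j. *)
Definition sample_pmf {R : realType} n T (Theta : 'I_T -> 'M[R]_n)
    (Pi : 'M[R]_n) (w : sample n T) : R :=
  \prod_(se : 'I_T * edge n)
    (bernoulli_pmf (Theta se.1 (val se.2).1 (val se.2).2) (w se).1 *
     bernoulli_pmf (Pi (val se.2).1 (val se.2).2) (w se).2).

(* The edge {i, j}; None on the diagonal. *)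
Definition edge_of n (i j : 'I_n) : option (edge n) :=
  insub (if (i < j)%N then (i, j) else (j, i)).

Definition obs {R : realType} n T (w : sample n T) : 'I_T -> 'M[R]_n :=
  fun s => \matrix_(i, j)
    if edge_of i j is Some e then ((w (s, e)).2 && (w (s, e)).1)%:R else 0.

(* The sample space is finite, so every {0,1}-valued function of Y is
   measurable. *)
Definition test (R : realType) n T := ('I_T -> 'M[R]_n) -> bool.

Definition IRGML_prob {R : realType} n T (Theta : 'I_T -> 'M[R]_n)
    (Pi : 'M[R]_n) (E : ('I_T -> 'M[R]_n) -> bool) : R :=
  \sum_(w : sample n T | E (obs w)) sample_pmf Theta Pi w.

Lemma IRGML_probT (R : realType) n T (Theta : 'I_T -> 'M[R]_n) Pi :
  IRGML_prob Theta Pi (fun=> true) = 1.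
Proof.
rewrite /IRGML_prob /sample_pmf.
rewrite -(bigA_distr_bigA (fun (se : 'I_T * edge n) (b : bool * bool) =>
  bernoulli_pmf (Theta se.1 (val se.2).1 (val se.2).2) b.1 *
  bernoulli_pmf (Pi (val se.2).1 (val se.2).2) b.2)) /=.
apply: big1 => se _.
rewrite -(pair_bigA _ (fun a b => bernoulli_pmf _ a * bernoulli_pmf _ b)) /=.
by rewrite !big_bool /= /bernoulli_pmf -!mulrDr !subrKC !mulr1 subrKC.
Qed.

Definition P0 {R : realType} n T (Theta0 Pi : 'M[R]_n)
    (E : ('I_T -> 'M[R]_n) -> bool) : R :=
  IRGML_prob (fun=> Theta0) Pi E.

Definition Pchange {R : realType} n T (tau : nat) (Thetaa Thetab Pi : 'M[R]_n)
    (E : ('I_T -> 'M[R]_n) -> bool) : R :=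
  IRGML_prob (fun s : 'I_T => if (s < tau)%N then Thetaa else Thetab) Pi E.

Definition DT (T : nat) : set nat := [set t | (0 < t < T)%N].

Definition Wn {R : realType} n (T tau : nat) (omega r : R) :
    set (('M[R]_n * 'M[R]_n) * ('M[R]_n * 'M[R]_n)) :=
  [set x | [/\ Sn omega x.1, Sn omega x.2, x.1.2 = x.2.2
             & r <= q (tau%:R / T%:R)
                    * opnorm (hadamard x.1.2 (x.1.1 - x.2.1))]].

(* The suprema below are over sets of probabilities; sup set0 = 0, so an empty
   alternative contributes the value 0. *)
Definition type1_error {R : realType} n T (omega : R) (psi : test R n T) : R :=
  sup [set P0 x.1 x.2 (fun Y => psi Y) | x in Sn omega].

Definition type2_error {R : realType} n T (omega r : R) (psi : test R n T) : R :=
  sup [set sup [set Pchange tau x.1.1 x.2.1 x.1.2 (fun Y => ~~ psi Y)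
               | x in Wn T tau omega r]
      | tau in DT T].

Definition cusum {R : realType} n T (Y : 'I_T -> 'M[R]_n) (t : nat) : 'M[R]_n :=
  Num.sqrt (t%:R * (T - t)%:R / T%:R) *:
    (t%:R^-1 *: (\sum_(s < T | (s < t)%N) Y s)
     - (T - t)%:R^-1 *: (\sum_(s < T | (t <= s)%N) Y s)).

Definition dyadic_grid (R : realType) (T : nat) : seq nat :=
  let K := Num.truncn (log2 (T%:R / 2) : R) in
  [seq (2 ^ k)%N | k <- iota 0 K.+1] ++ [seq (T - 2 ^ k)%N | k <- iota 0 K.+1].

Definition threshold {R : realType} (eps Ceps omega alpha : R) (n T : nat) : R :=
  2 * Num.sqrt 2 * (1 + eps) * Num.sqrt omega
  + Ceps * ln (4 * n%:R * log2 T%:R / alpha).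

Definition cusum_test {R : realType} n T (H : R) : test R n T := fun Y =>
  \big[Num.max/0]_(t <- dyadic_grid R T) opnorm (cusum Y t) > H.

(* Main.v *)
Require Import Defs.
From HB Require Import structures.
From mathcomp Require Import all_boot all_order all_algebra.
From mathcomp Require Import all_classical all_reals all_analysis.
From mathcomp Require Import zify ring lra.

Set Implicit Arguments.
Unset Strict Implicit.
Unset Printing Implicit Defensive.

Import Order.TTheory GRing.Theory Num.Theory.

Local Open Scope ring_scope.

(** Both error bounds follow from one concentration inequality for the matrix
    CUSUM statistic Z around its mean EZ at a fixed time: with probability at
    least 1 - n e^(-L), ||Z - EZ|| is less than
    2 sqrt 2 (1 + eps) sqrt omega + 36 L / eps.  A union bound over the dyadic
    grid gives the level; for the power, some grid point t satisfies
    ||EZ(t)|| >= sqrt (T / 3) r.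

    The concentration inequality is a sharp trace-moment bound.  If Z' is an
    independent copy of Z, Jensen's inequality gives, for N even,
    E ||Z - EZ||^N <= E tr (Z - Z')^N, and the entries of Z - Z' are sums of
    independent symmetric variables (one per time and edge, called labels)
    bounded by 1, with row variances at most 2 omega.  The trace expands into
    closed walks of length N whose steps carry labels; only walks using each
    label an even number of times contribute.  Explore such a walk step by step
    and call a label pending if it has been used an odd number of times so far.
    A step either opens a pending label, which costs the row variance when the
    vertex reached is on no pending label and O(N) otherwise, or closes one of
    the pending labels at the current vertex.  Closing is unambiguous unless
    several labels are pending there, and each ambiguous closing (at most N
    choices) can be charged to an earlier opening step of the second kind.  As
    half of the steps are openings, the walks contribute at most
    n (2 s)^N with s^2 = 2 omega + 5 N^2.  Markov's inequality with N of order
    L / eps concludes. *)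

(** * Sums over labelled walks *)

Section Walks.
Variables (V J : finType) (e1 e2 : J -> V).
Hypothesis e12 : forall j, e1 j != e2 j.

Definition incident (j : J) (u : V) := (u == e1 j) || (u == e2 j).
Definition other_end (j : J) (u : V) := if u == e1 j then e2 j else e1 j.
(** [c j] records how often label [j] has been used; the label is pending when [c j] is odd, so
    [odd_count] and [odd_deg] count pending labels, overall and at a vertex. *)
Definition bump (c : J -> nat) (j : J) : J -> nat := fun i => (c i + (i == j))%N.
Definition odd_count (c : J -> nat) : nat := \sum_j odd (c j).
Definition odd_deg (c : J -> nat) (u : V) : nat := \sum_(j | incident j u) odd (c j).
(* Bounds the number of closing steps with a choice still to come from the
   current vertex [v], those enabled by later openings aside: at the current vertex a closing step is ambiguous as long as
   at least two labels are pending, while at any other vertex one pending label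
   is spent by the next arrival. *)
Definition ambiguity (c : J -> nat) (v : V) : nat :=
  ((odd_deg c v)./2 + \sum_(u | u != v) (odd_deg c u).-1./2)%N.

Lemma other_end_neq j v : other_end j v != v.
Proof.
rewrite /other_end; case: ifP => [/eqP->|]; first by rewrite eq_sym.
by rewrite eq_sym => ->.
Qed.

Lemma incidentE j v u : incident j v -> incident j u = (u == v) || (u == other_end j v).
Proof.
rewrite /incident /other_end => /orP[] /eqP ->; first by rewrite eqxx.
by rewrite [e2 j == e1 j]eq_sym (negbTE (e12 j)) orbC.
Qed.

Lemma odd_bump c j i : odd (bump c j i) = odd (c i) (+) (i == j).
Proof. by rewrite /bump oddD; case: (i == j). Qed.

Lemma sum_bump c j : (\sum_i bump c j i = (\sum_i c i).+1)%N.
Proof.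
rewrite big_split /= -[RHS]addn1; congr (_ + _)%N.
by rewrite (bigD1 j) //= eqxx big1 // => i /negbTE ->.
Qed.

Lemma odd_count_bump_odd c j : odd (c j) -> (odd_count (bump c j)).+1 = odd_count c.
Proof.
move=> oj; rewrite /odd_count (bigD1 j) //= [RHS](bigD1 j) //= odd_bump eqxx oj /=.
by rewrite add0n add1n; congr _.+1; apply: eq_bigr => i /negbTE ij; rewrite odd_bump ij addbF.
Qed.

Lemma odd_count_bump_even c j : ~~ odd (c j) -> odd_count (bump c j) = (odd_count c).+1.
Proof.
move=> oj; rewrite /odd_count (bigD1 j) //= [in RHS](bigD1 j) //= odd_bump eqxx (negbTE oj) /=.
by rewrite add0n add1n; congr _.+1; apply: eq_bigr => i /negbTE ij; rewrite odd_bump ij addbF.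
Qed.

Lemma odd_deg_bump_out c j u : ~~ incident j u -> odd_deg (bump c j) u = odd_deg c u.
Proof.
move=> ju; apply: eq_bigr => i iu; rewrite odd_bump; case: eqP => [ij|]; last by rewrite addbF.
by rewrite -ij iu in ju.
Qed.

Lemma odd_deg_bump_odd c j u : incident j u -> odd (c j) -> (odd_deg (bump c j) u).+1 = odd_deg c u.
Proof.
move=> ju oj; rewrite /odd_deg (bigD1 j) //= [RHS](bigD1 j) //= odd_bump eqxx oj /=.
rewrite add0n add1n; congr _.+1; apply: eq_bigr => i /andP[_ /negbTE ij].
by rewrite odd_bump ij addbF.
Qed.

Lemma odd_deg_bump_even c j u : incident j u -> ~~ odd (c j) -> odd_deg (bump c j) u = (odd_deg c u).+1.
Proof.
move=> ju oj; rewrite /odd_deg (bigD1 j) //= [in RHS](bigD1 j) //= odd_bump eqxx (negbTE oj) /=.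
rewrite add0n add1n; congr _.+1; apply: eq_bigr => i /andP[_ /negbTE ij].
by rewrite odd_bump ij addbF.
Qed.

(** A step along [j] alters pending degrees only at its two ends, so both ambiguities share the sum
    over all other vertices and only two degrees remain to be compared. *)
Lemma ambiguity_bump_split c j v : incident j v ->
  ambiguity c v = ((odd_deg c v)./2 + ((odd_deg c (other_end j v)).-1./2
             + \sum_(u | ~~ incident j u) (odd_deg c u).-1./2))%N /\
  ambiguity (bump c j) (other_end j v) =
    ((odd_deg (bump c j) (other_end j v))./2 + ((odd_deg (bump c j) v).-1./2
             + \sum_(u | ~~ incident j u) (odd_deg c u).-1./2))%N.
Proof.
move=> jv; have nv := other_end_neq j v; split; rewrite /ambiguity; congr (_ + _)%N.
  rewrite (bigD1 (other_end j v)) //=; congr (_ + _)%N; apply: eq_bigl => u.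
  by rewrite (incidentE _ jv) negb_or.
rewrite (bigD1 v) 1?eq_sym //=; congr (_ + _)%N.
rewrite [RHS](eq_bigl (fun u => (u != other_end j v) && (u != v))).
  by apply: eq_bigr => u /andP[h1 h2]; rewrite odd_deg_bump_out // (incidentE _ jv) negb_or h1 h2.
by move=> u; rewrite (incidentE _ jv) negb_or andbC.
Qed.

Lemma incident_other_end j v : incident j v -> incident j (other_end j v).
Proof. by move=> jv; rewrite (incidentE _ jv) eqxx orbT. Qed.

(** The other end loses a pending label but becomes current, which leaves its contribution
    unchanged. With [d] labels pending at [v], the contribution of [v] passes from [d./2] to
    [(d - 2)./2], one unit less exactly when the closing was ambiguous. *)
Lemma ambiguity_bump_odd c j v : incident j v -> odd (c j) ->
  (ambiguity (bump c j) (other_end j v) + (1 < odd_deg c v))%N = ambiguity c v.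
Proof.
move=> jv oj; have [-> ->] := ambiguity_bump_split c jv.
rewrite -!(odd_deg_bump_odd _ oj) ?incident_other_end //; case: (odd_deg _ v) => [|d] /=; lia.
Qed.

(** The contribution of [v] stays at [d./2], while that of the other end, with [e] labels pending,
    passes from [(e - 1)./2] to [(e + 1)./2]; truncation absorbs the gain when [e = 0]. *)
Lemma ambiguity_bump_even c j v : incident j v -> ~~ odd (c j) ->
  ambiguity (bump c j) (other_end j v) = (ambiguity c v + (0 < odd_deg c (other_end j v)))%N.
Proof.
move=> jv oj; have [-> ->] := ambiguity_bump_split c jv.
rewrite !(odd_deg_bump_even _ oj) ?incident_other_end //; case: (odd_deg _ (other_end j v)) => [|d] /=; lia.
Qed.

Lemma odd_deg_le_count c u : (odd_deg c u <= odd_count c)%N.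
Proof. by rewrite /odd_count (bigID (incident^~ u)) /= leq_addr. Qed.

Lemma odd_count_le c : (odd_count c <= \sum_j c j)%N.
Proof. by apply: leq_sum => j _; case: (c j) => // k; case: (odd _). Qed.

(** Double counting: a pending label has two ends and has been used at least once. *)
Lemma card_odd_deg_gt0 c : (#|[pred u | 0 < odd_deg c u]| <= 2 * \sum_j c j)%N.
Proof.
apply: (@leq_trans (\sum_u odd_deg c u)); first by
  rewrite -sum1_card [leqRHS](bigID [pred u | 0 < odd_deg c u]%N) /=;
  apply: leq_trans (leq_addr _ _); apply: leq_sum.
rewrite /odd_deg (exchange_big_dep xpredT) //= mul2n -addnn -big_split /=; apply: leq_sum => j _.
rewrite sum_nat_const (_ : #|_| = 2) //; last first.
  rewrite (eq_card (B := pred2 (e1 j) (e2 j))) ?card2 ?e12 //.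
have oc : (odd (c j) <= c j)%N by case: (c j) => // k; case: (odd _).
by rewrite mul2n -addnn leq_add.
Qed.

Variable R : realFieldType.

(* When [phi c] is the expectation of \prod_j eta_j ^+ c j, this is the
   expectation of \prod_j eta_j ^+ c j times the (v, u) entry of the [l]-th
   power of the matrix with entries sums of labels. *)
Fixpoint walksum (phi : (J -> nat) -> R) (u : V) (l : nat) (v : V) (c : J -> nat) : R :=
  if l is l'.+1 then \sum_(j | incident j v) walksum phi u l' (other_end j v) (bump c j)
  else (v == u)%:R * phi c.

(** Each label used is charged [b j] once, whatever its multiplicity: for variables bounded by 1,
    all higher moments are at most the second. *)
Definition support_weight (b : J -> R) (c : J -> nat) := \prod_(j | (0 < c j)%N) b j.

Lemma support_weight_bump_new b c j : c j = 0%N ->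
  support_weight b (bump c j) = b j * support_weight b c.
Proof.
move=> cj; rewrite /support_weight (bigD1 j) /=; last by rewrite /bump eqxx addn1.
congr (_ * _); apply: eq_bigl => i; rewrite /bump; case: eqP => [->|]; first by rewrite andbF cj.
by rewrite addn0 andbT.
Qed.

Lemma support_weight_bump_old b c j : (0 < c j)%N ->
  support_weight b (bump c j) = support_weight b c.
Proof.
move=> cj; apply: eq_bigl => i; rewrite /bump; case: eqP => [->|]; last by rewrite addn0.
by rewrite addn1 cj.
Qed.

Variables (b : J -> R) (sigma2 kappa s : R) (N : nat).
Hypothesis N_gt0 : (0 < N)%N.
Hypothesis b_ge0 : forall j, 0 <= b j.
Hypothesis b_inc : forall v, \sum_(j | incident j v) b j <= sigma2.
Hypothesis b_pair : forall v u, \sum_(j | incident j v && (other_end j v == u)) b j <= kappa.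
Hypothesis s_gt0 : 0 < s.
Hypothesis s2E : sigma2 + (1 + 2 * kappa) * N%:R ^+ 2 <= s ^+ 2.
Variable phi : (J -> nat) -> R.
Hypothesis phi_le : forall c, phi c <= support_weight b c.
Hypothesis phi_odd : forall c j, odd (c j) -> phi c = 0.

Lemma support_weight_ge0 c : 0 <= support_weight b c.
Proof. exact: prodr_ge0. Qed.

(** If every label ends up even, closings outnumber openings by [odd_count c] among the [l]
    remaining steps. A cost [s ^+ 2] per opening and 1 per closing gives
    [s ^+ l / s ^+ odd_count c]; the factor [2 ^+ l] counts the patterns of openings and closings,
    and the power of [N] prepays ambiguous closings. *)
Definition walk_bound l v c : R :=
  support_weight b c * N%:R ^+ ambiguity c v * (2 * s) ^+ l / s ^+ odd_count c.

Lemma walk_bound_ge0 l v c : 0 <= walk_bound l v c.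
Proof.
by rewrite /walk_bound !(mulr_ge0, invr_ge0, exprn_ge0) ?support_weight_ge0 ?ler0n ?ltW.
Qed.

Lemma walksum0_le u v c : walksum phi u 0 v c <= walk_bound 0 v c.
Proof.
rewrite /=; have [h0|] := posnP (odd_count c); last first.
  rewrite lt0n sum_nat_eq0 negb_forall => /existsP[j]; rewrite /= eqb0 negbK => oj.
  by rewrite (phi_odd oj) mulr0 walk_bound_ge0.
rewrite /walk_bound h0 !expr0 divr1 mulr1.
apply: (@le_trans _ _ (support_weight b c)).
  case: (_ == _); rewrite ?mul1r ?mul0r //; exact: support_weight_ge0.
by rewrite ler_peMr ?support_weight_ge0 // exprn_ege1 // ler1n.
Qed.

(* The three cases: closing a pending label, reopening a label already used,
   using a new label; the cost [N] of an ambiguous choice is charged to the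
   steps that raise [ambiguity]. *)
Definition step_factor (c : J -> nat) (v : V) (j : J) : R :=
  if odd (c j) then s ^+ 2 / N%:R ^+ (1 < odd_deg c v)
  else if (0 < c j)%N then N%:R
  else b j * (1 + N%:R * (0 < odd_deg c (other_end j v))%:R).

Lemma walk_bound_step l v c j : incident j v ->
  walk_bound l (other_end j v) (bump c j) <= walk_bound l v c / s * step_factor c v j.
Proof.
move=> jv; have sn0 : s != 0 by rewrite gt_eqF.
have Nn0 : N%:R != 0 :> R by rewrite pnatr_eq0 -lt0n.
have N1 : 1 <= N%:R :> R by rewrite ler1n.
rewrite /step_factor; case: ifPn => oj.
  rewrite /walk_bound -(ambiguity_bump_odd jv oj) -(odd_count_bump_odd oj).
  rewrite support_weight_bump_old ?odd_gt0 // exprD exprS.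
  rewrite le_eqVlt; apply/orP; left; apply/eqP; field.
  by rewrite !expf_neq0 ?sn0.
rewrite /walk_bound (ambiguity_bump_even jv oj) (odd_count_bump_even oj) exprD exprS.
set A := N%:R ^+ ambiguity c v; set B := (2 * s) ^+ l; set C := s ^+ odd_count c.
have C0 : C != 0 by rewrite expf_neq0.
have P0 := support_weight_ge0 c; have A0 : 0 <= A by rewrite exprn_ge0.
have B0 : 0 <= B by rewrite exprn_ge0 // mulr_ge0 // ltW.
have Ci0 : 0 <= C by rewrite exprn_ge0 // ltW.
have W0 : 0 <= support_weight b c * A * B / (s * C).
  by rewrite divr_ge0 ?mulr_ge0 // ltW.
have W1 : support_weight b c * A * B / C / s = support_weight b c * A * B / (s * C).
  by field; rewrite sn0 C0.
rewrite W1; case: ifPn => [cj|]; [rewrite support_weight_bump_old //|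
  rewrite lt0n negbK => /eqP cj; rewrite support_weight_bump_new //].
  rewrite (_ : support_weight b c * (A * _) * B / (s * C) =
    support_weight b c * A * B / (s * C) * N%:R ^+ (0 < odd_deg c (other_end j v))); last by ring.
  by apply: ler_wpM2l => //; case: (0 < _)%N; rewrite ?expr1 ?expr0.
rewrite (_ : b j * support_weight b c * (A * _) * B / (s * C) =
    support_weight b c * A * B / (s * C) * (b j * N%:R ^+ (0 < odd_deg c (other_end j v)))); last by ring.
(* A power of [N] with exponent 0 or 1 is bounded by a sum, so that the row variance separates from
   the part reaching vertices on pending labels. *)
apply: ler_wpM2l => //; apply: ler_wpM2l => //.
by case: (0 < _)%N; rewrite ?expr1 ?expr0 ?mulr1 ?mulr0 ?addr0 // lerDr.
Qed.

(** Closings and openings each contribute at most [s ^+ 2]. Among openings, at most [N] old labels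
    cost [N] each; new labels cost [sigma2], plus [N * kappa] for each of the at most [2 * N]
    vertices on pending labels. [s2E] collects these terms. *)
Lemma sum_step_factor v c : (\sum_j c j < N)%N ->
  \sum_(j | incident j v) step_factor c v j <= 2 * s ^+ 2.
Proof.
move=> cN; have dN : (odd_deg c v <= N)%N.
  exact: leq_trans (odd_deg_le_count _ _) (leq_trans (odd_count_le _) (ltnW cN)).
have kappa0 : 0 <= kappa.
  by apply: le_trans (b_pair v v); apply: sumr_ge0.
have N0 : 0 <= N%:R :> R by [].
have s20 : 0 <= s ^+ 2 by rewrite exprn_ge0 // ltW.
apply: (@le_trans _ _ (\sum_(j | incident j v) (odd (c j))%:R * (s ^+ 2 / N%:R ^+ (1 < odd_deg c v))
   + \sum_(j | incident j v) (0 < c j)%N%:R * N%:R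
   + \sum_(j | incident j v) b j
   + \sum_(j | incident j v) b j * (N%:R * (0 < odd_deg c (other_end j v))%N%:R))).
  rewrite -!big_split /=; apply: ler_sum => j _; rewrite /step_factor.
  have b0 := b_ge0 j.
  have q0 : 0 <= N%:R * (0 < odd_deg c (other_end j v))%N%:R :> R by rewrite mulr_ge0.
  have w0 : 0 <= b j * (N%:R * (0 < odd_deg c (other_end j v))%N%:R) by rewrite mulr_ge0.
  have z0 : 0 <= s ^+ 2 / N%:R ^+ (1 < odd_deg c v) by rewrite divr_ge0 // exprn_ge0.
  have p0 : 0 <= (0 < c j)%N%:R * N%:R :> R by rewrite mulr_ge0.
  case: ifP => _; rewrite ?mul1r ?mul0r; last case: ifP p0 => _; rewrite ?mul1r ?mul0r; lra.
rewrite -mulr_suml -!addrA; rewrite [2 * _]mulr_natl mulr2n; apply: lerD.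
  (* With several labels pending at [v], the at most [N] choices are offset by the division by [N];
     with none or one there is nothing to offset. *)
  rewrite -natr_sum -/(odd_deg c v); case: (ltngtP 1 (odd_deg c v)) dN => /= [dv|dv|<-] dN.
  - by rewrite expr1 mulrCA ler_piMr // ler_pdivrMr ?ltr0n // mul1r ler_nat.
  - by move: dv; rewrite ltnS leqn0 => /eqP ->; rewrite mul0r.
  - by rewrite expr0 divr1 mul1r.
apply: le_trans s2E; rewrite addrCA; apply: lerD (b_inc v) _.
rewrite mulrDl mul1r; apply: lerD.
  rewrite -mulr_suml expr2 ler_wpM2r // -natr_sum ler_nat.
  apply: leq_trans (ltnW cN); rewrite [leqRHS](bigID (incident^~ v)) /=.
  by apply: leq_trans (leq_addr _ _); apply: leq_sum => j _; case: (c j).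
(* Grouping by the vertex reached makes [b_pair] applicable to each group. *)
rewrite (partition_big (fun j => other_end j v) predT) //=.
apply: (@le_trans _ _ (\sum_u kappa * (N%:R * (0 < odd_deg c u)%N%:R))).
  apply: ler_sum => u _; rewrite (eq_bigr (fun j => b j * (N%:R * (0 < odd_deg c u)%N%:R))).
    by rewrite -mulr_suml ler_wpM2r // mulr_ge0.
  by move=> j /andP[_ /eqP ->].
rewrite -mulr_sumr -mulr_sumr -natr_sum -big_mkcond sum1_card /=.
have : (#|[pred u | 0 < odd_deg c u]| <= 2 * N)%N.
  by apply: leq_trans (card_odd_deg_gt0 c) _; rewrite leq_mul2l /= ltnW.
rewrite -(ler_nat R) natrM => h.
rewrite (_ : 2 * kappa * N%:R ^+ 2 = kappa * (N%:R * (2 * N%:R))); last by ring.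
by do 2 apply: ler_wpM2l => //.
Qed.

Lemma walksum_le l u v c : (\sum_j c j + l <= N)%N ->
  walksum phi u l v c <= walk_bound l v c.
Proof.
elim: l v c => [|l IH] v c cN; first exact: walksum0_le.
have -> : walk_bound l.+1 v c = walk_bound l v c / s * (2 * s ^+ 2).
  by rewrite /walk_bound exprS; field; rewrite expf_neq0 ?gt_eqF.
apply: (@le_trans _ _ (\sum_(j | incident j v) walk_bound l v c / s * step_factor c v j)).
  apply: ler_sum => j jv; apply: le_trans (walk_bound_step l c jv).
  by apply: IH; rewrite sum_bump addSn -addnS.
rewrite -mulr_sumr; apply: ler_wpM2l.
  by apply: divr_ge0; [exact: walk_bound_ge0 | exact: ltW].
by apply: sum_step_factor; apply: leq_trans cN; rewrite addnS ltnS leq_addr.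
Qed.

Lemma walksum_closed_le u v : walksum phi u N v (fun=> 0%N) <= (2 * s) ^+ N.
Proof.
have := @walksum_le N u v (fun=> 0%N); rewrite sum_nat_const muln0 => /(_ (leqnn _)).
move=> /le_trans; apply; rewrite /walk_bound /odd_count big1 // expr0 divr1.
have d0 x : odd_deg (fun=> 0%N) x = 0%N by rewrite /odd_deg big1.
by rewrite /ambiguity d0 big1 ?expr0 ?mulr1 /support_weight ?big_pred0 ?mul1r // => x _; rewrite d0.
Qed.

End Walks.

(** * Trace moments of symmetrized random matrices *)

Section SymmetrizedMoments.
Variables (R : realFieldType) (n : nat) (J K : finType) (e1 e2 : J -> 'I_n).
Hypothesis e12 : forall j, e1 j != e2 j.
Variables (mu : J -> K -> R) (eta : J -> K -> K -> R).
Hypothesis mu_ge0 : forall j k, 0 <= mu j k.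
Hypothesis mu1 : forall j, \sum_k mu j k = 1.
Hypothesis eta_anti : forall j k k', eta j k k' = - eta j k' k.
Hypothesis eta_le1 : forall j k k', `|eta j k k'| <= 1.

Definition prod_pmf (w : {ffun J -> K}) : R := \prod_j mu j (w j).

Definition expect2 (F : {ffun J -> K} -> {ffun J -> K} -> R) : R :=
  \sum_w \sum_w' prod_pmf w * prod_pmf w' * F w w'.

Definition moment j m : R := \sum_k \sum_k' mu j k * mu j k' * eta j k k' ^+ m.

(** Independence of the labels, in the form of distributivity of products over sums. *)
Lemma expect2_prod (f : J -> K -> K -> R) :
  expect2 (fun w w' => \prod_j f j (w j) (w' j)) =
  \prod_j \sum_k \sum_k' mu j k * mu j k' * f j k k'.
Proof.
rewrite bigA_distr_bigA /=; apply: eq_bigr => w _.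
rewrite bigA_distr_bigA /=; apply: eq_bigr => w' _.
by rewrite -!big_split.
Qed.

Lemma expect2_sum (I : finType) (P : pred I) (F : I -> {ffun J -> K} -> {ffun J -> K} -> R) :
  expect2 (fun w w' => \sum_(i | P i) F i w w') = \sum_(i | P i) expect2 (F i).
Proof.
rewrite [RHS]exchange_big /=; apply: eq_bigr => w _.
by rewrite [RHS]exchange_big /=; apply: eq_bigr => w' _; rewrite mulr_sumr.
Qed.

Definition label_mx (x : J -> R) : 'M[R]_n :=
  \matrix_(v, u) \sum_(j | incident e1 e2 j v && (other_end e1 e2 j v == u)) x j.

Lemma label_mx_exprS x l v u : (label_mx x ^+ l.+1) v u =
  \sum_(j | incident e1 e2 j v) x j * (label_mx x ^+ l) (other_end e1 e2 j v) u.
Proof.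
rewrite exprS !mxE (partition_big (fun j => other_end e1 e2 j v) predT) //=.
apply: eq_bigr => y _; rewrite mxE mulr_suml.
by apply: eq_bigr => j /andP[_ /eqP ->].
Qed.

(** The monomial with exponents [c] carries the labels already traversed. Peeling off the first step
    of a walk raises one exponent, which is the recursion of [walksum]. *)
Lemma expect2_walk u l v c :
  expect2 (fun w w' => \prod_j eta j (w j) (w' j) ^+ c j *
             (label_mx (fun j => eta j (w j) (w' j)) ^+ l) v u) =
  walksum e1 e2 (fun c => \prod_j moment j (c j)) u l v c.
Proof.
elim: l v c => [|l IH] v c /=.
  rewrite /moment -expect2_prod /expect2 mulr_sumr; apply: eq_bigr => w _.
  rewrite mulr_sumr; apply: eq_bigr => w' _.
  by rewrite expr0 mxE mulrA [in RHS]mulrC -mulr_natr mul1r.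
under [RHS]eq_bigr do rewrite -IH.
rewrite -expect2_sum; apply: eq_bigr => w _; apply: eq_bigr => w' _; congr (_ * _).
rewrite label_mx_exprS mulr_sumr; apply: eq_bigr => j jv; rewrite mulrA; congr (_ * _).
rewrite [RHS](bigD1 j) //= [in LHS](bigD1 j) //= /bump eqxx exprD expr1.
rewrite mulrAC; congr (_ * _); apply: eq_bigr => i /negbTE ->.
by rewrite addn0.
Qed.

Lemma moment0 j : moment j 0 = 1.
Proof.
rewrite /moment; under eq_bigr => k _ do
  (under eq_bigr do rewrite expr0 mulr1; rewrite -mulr_sumr mu1 mulr1).
exact: mu1.
Qed.

(** Exchanging the two independent copies reverses the sign of [eta]. *)
Lemma moment_odd j m : odd m -> moment j m = 0.
Proof.
move=> om; suff : moment j m = - moment j m by lra.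
rewrite {1}/moment exchange_big /= -sumrN; apply: eq_bigr => k _.
rewrite -sumrN; apply: eq_bigr => k' _.
by rewrite (eta_anti j k' k) exprNn -signr_odd om expr1; ring.
Qed.

Lemma moment_ge0 j m : 0 <= moment j m.
Proof.
case om : (odd m); first by rewrite moment_odd.
apply: sumr_ge0 => k _; apply: sumr_ge0 => k' _.
by rewrite !mulr_ge0 // exprn_even_ge0 // om.
Qed.

Lemma moment_le j m : (0 < m)%N -> moment j m <= moment j 2.
Proof.
case om : (odd m); first by rewrite moment_odd // moment_ge0.
case: m om => // -[//|m] om _; apply: ler_sum => k _; apply: ler_sum => k' _.
apply: ler_wpM2l; first by rewrite mulr_ge0.
apply: le_trans (ler_norm _) _; rewrite normrX -[leRHS]real_normK ?num_real //.
by rewrite ler_wiXn2l.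
Qed.

Variables (b : J -> R) (sigma2 kappa s : R) (N : nat).
Hypothesis N_gt0 : (0 < N)%N.
Hypothesis moment2_le : forall j, moment j 2 <= b j.
Hypothesis b_inc : forall v, \sum_(j | incident e1 e2 j v) b j <= sigma2.
Hypothesis b_pair : forall v u,
  \sum_(j | incident e1 e2 j v && (other_end e1 e2 j v == u)) b j <= kappa.
Hypothesis s_gt0 : 0 < s.
Hypothesis s2E : sigma2 + (1 + 2 * kappa) * N%:R ^+ 2 <= s ^+ 2.

Lemma expect2_trace_le :
  expect2 (fun w w' => \tr (label_mx (fun j => eta j (w j) (w' j)) ^+ N))
    <= n%:R * (2 * s) ^+ N.
Proof.
have b0 j : 0 <= b j by apply: le_trans (moment2_le j); exact: moment_ge0.
rewrite /mxtrace expect2_sum.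
have -> : n%:R * (2 * s) ^+ N = \sum_(i < n) (2 * s) ^+ N.
  by rewrite sumr_const card_ord mulr_natl.
apply: ler_sum => v _.
apply: le_trans (walksum_closed_le e12 N_gt0 b0 b_inc b_pair s_gt0 s2E
  (phi := fun c => \prod_j moment j (c j)) _ _ v v); last first.
- by move=> c j oj; rewrite (bigD1 j) //= moment_odd // mul0r.
- move=> c; rewrite /support_weight [leRHS]big_mkcond; apply: ler_prod => j _.
  rewrite moment_ge0 /=; case: ifPn => cj; first exact: le_trans (moment_le _ cj) _.
  by move: cj; rewrite lt0n negbK => /eqP ->; rewrite moment0.
rewrite -expect2_walk le_eqVlt; apply/orP; left; apply/eqP.
apply: eq_bigr => w _; apply: eq_bigr => w' _; congr (_ * _).
by rewrite big1 ?mul1r // => j _; rewrite expr0.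
Qed.

End SymmetrizedMoments.

(** * Euclidean and operator norms *)

Local Open Scope classical_set_scope.
Local Open Scope ring_scope.

Section EuclideanNorm.
Variables (R : realType) (n : nat).
Implicit Types (u v : 'cV[R]_n) (M A B : 'M[R]_n).

Definition dot u v : R := \sum_i u i ord0 * v i ord0.

(** Lagrange's identity: twice the gap is a double sum of squares. *)
Lemma sum_CauchySchwarz (I : finType) (x y : I -> R) :
  (\sum_i x i * y i) ^+ 2 <= (\sum_i x i ^+ 2) * (\sum_i y i ^+ 2).
Proof.
rewrite -subr_ge0 -(pmulr_lge0 _ (ltr0n R 2)).
have -> : ((\sum_i x i ^+ 2) * (\sum_i y i ^+ 2) - (\sum_i x i * y i) ^+ 2) * 2
   = \sum_i \sum_j (x i * y j - x j * y i) ^+ 2.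
  set A := \sum_i x i ^+ 2; set B := \sum_i y i ^+ 2; set C := \sum_i x i * y i.
  have -> : (A * B - C ^+ 2) * 2 = A * B + B * A - (C * C + C * C) by ring.
  rewrite !big_distrlr /= -!big_split /= -sumrB.
  apply: eq_bigr => i _; rewrite -!big_split -sumrB /=.
  by apply: eq_bigr => j _; ring.
by apply: sumr_ge0 => i _; apply: sumr_ge0 => j _; exact: sqr_ge0.
Qed.

Lemma enorm_ge0 v : 0 <= enorm v. Proof. exact: sqrtr_ge0. Qed.

Lemma sqr_enorm v : enorm v ^+ 2 = dot v v.
Proof.
rewrite sqr_sqrtr; first by apply: eq_bigr => i _; rewrite expr2.
by apply: sumr_ge0 => i _; exact: sqr_ge0.
Qed.

Lemma dot_le_enorm u v : dot u v <= enorm u * enorm v.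
Proof.
have uv0 : 0 <= enorm u * enorm v by rewrite mulr_ge0 ?enorm_ge0.
apply: le_trans (ler_norm _) _; rewrite -(ler_pXn2r (ltn0Sn 1)) ?nnegrE //.
rewrite real_normK ?num_real // exprMn !sqr_enorm.
apply: le_trans (sum_CauchySchwarz _ _) _.
rewrite le_eqVlt; apply/orP; left; apply/eqP.
by congr (_ * _); apply: eq_bigr => i _; rewrite expr2.
Qed.

Lemma dotDl u v w : dot (u + v) w = dot u w + dot v w.
Proof. by rewrite -big_split; apply: eq_bigr => i _; rewrite mxE mulrDl. Qed.

Lemma dotC u v : dot u v = dot v u.
Proof. by apply: eq_bigr => i _; rewrite mulrC. Qed.

Lemma enormD u v : enorm (u + v) <= enorm u + enorm v.
Proof.
have uv0 : 0 <= enorm u + enorm v by rewrite addr_ge0 ?enorm_ge0.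
rewrite -(ler_pXn2r (ltn0Sn 1)) ?nnegrE ?enorm_ge0 //.
rewrite sqrrD !sqr_enorm dotDl ![dot _ (u + v)]dotC !dotDl (dotC v u).
by have := dot_le_enorm u v; rewrite mulr2n; lra.
Qed.

Lemma enormZ a v : enorm (a *: v) = `|a| * enorm v.
Proof.
rewrite /enorm -sqrtr_sqr -sqrtrM ?sqr_ge0 // mulr_sumr.
by congr (Num.sqrt _); apply: eq_bigr => i _; rewrite mxE exprMn.
Qed.

Lemma enorm0 : enorm (0 : 'cV[R]_n) = 0.
Proof. by rewrite -(scale0r 0) enormZ normr0 mul0r. Qed.

Lemma enorm_mulmx_frobenius M v :
  enorm (M *m v) ^+ 2 <= \tr (M *m M^T) * enorm v ^+ 2.
Proof.
rewrite !sqr_enorm mulr_suml; apply: ler_sum => i _; rewrite -expr2 !mxE.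
apply: le_trans (sum_CauchySchwarz _ _) _.
rewrite le_eqVlt; apply/orP; left; apply/eqP; congr (_ * _); apply: eq_bigr => j _.
by rewrite mxE expr2.
Qed.

Lemma frobenius_ge0 M : 0 <= \tr (M *m M^T).
Proof.
apply: sumr_ge0 => i _; rewrite mxE; apply: sumr_ge0 => j _.
by rewrite mxE -expr2 sqr_ge0.
Qed.

Definition unit_image M := [set enorm (M *m v) | v in [set v : 'cV[R]_n | enorm v <= 1]].

Lemma unit_image_nonempty M : unit_image M !=set0.
Proof. by exists (enorm (M *m 0)), 0 => //=; rewrite enorm0 ler01. Qed.

(** The Frobenius norm is an upper bound, so the [sup] in [opnorm] is a true supremum and not its
    default value. *)
Lemma unit_image_has_sup M : has_sup (unit_image M).
Proof.
split; first exact: unit_image_nonempty.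
exists (Num.sqrt (\tr (M *m M^T))) => _ [v /= v1 <-].
rewrite -(ler_pXn2r (ltn0Sn 1)) ?nnegrE ?enorm_ge0 ?sqrtr_ge0 //.
rewrite [leRHS]sqr_sqrtr ?frobenius_ge0 //.
apply: le_trans (enorm_mulmx_frobenius _ _) _.
by rewrite ler_piMr ?frobenius_ge0 // exprn_ile1 ?enorm_ge0.
Qed.

Lemma enorm_le_opnorm M v : enorm v <= 1 -> enorm (M *m v) <= opnorm M.
Proof. by move=> v1; apply: (sup_upper_bound (unit_image_has_sup M)); exists v. Qed.

Lemma opnorm_le M a : (forall v, enorm v <= 1 -> enorm (M *m v) <= a) -> opnorm M <= a.
Proof.
by move=> h; apply: ge_sup; [exact: unit_image_nonempty | move=> _ [v v1 <-]; exact: h].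
Qed.

Lemma opnorm_ge0 M : 0 <= opnorm M.
Proof.
by apply: le_trans (enorm_ge0 (M *m 0)) (enorm_le_opnorm _ _); rewrite enorm0 ler01.
Qed.

Lemma opnormD A B : opnorm (A + B) <= opnorm A + opnorm B.
Proof.
apply: opnorm_le => v v1; rewrite mulmxDl; apply: le_trans (enormD _ _) _.
by apply: lerD; exact: enorm_le_opnorm.
Qed.

Lemma opnormZ_le a A : opnorm (a *: A) <= `|a| * opnorm A.
Proof.
apply: opnorm_le => v v1; rewrite -scalemxAl enormZ.
by apply: ler_wpM2l => //; exact: enorm_le_opnorm.
Qed.

Lemma opnormZ a A : 0 < a -> opnorm (a *: A) = a * opnorm A.
Proof.
move=> a0; apply/eqP; rewrite eq_le; apply/andP; split.
  by rewrite -{2}(gtr0_norm a0) opnormZ_le.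
rewrite -ler_pdivlMl //; have := opnormZ_le a^-1 (a *: A).
by rewrite scalerK ?gt_eqF // gtr0_norm ?invr_gt0.
Qed.

Lemma opnorm_zero : opnorm (0 : 'M[R]_n) = 0.
Proof.
apply/eqP; rewrite eq_le opnorm_ge0 andbT.
by apply: opnorm_le => v _; rewrite mul0mx enorm0.
Qed.

Lemma opnorm_sum (I : finType) (F : I -> 'M[R]_n) :
  opnorm (\sum_i F i) <= \sum_i opnorm (F i).
Proof.
elim/big_ind2 : _ => //; first by rewrite opnorm_zero.
by move=> A a B c hA hB; apply: le_trans (opnormD _ _) (lerD hA hB).
Qed.

Lemma dot_sym M u v : M^T = M -> dot (M *m u) v = dot u (M *m v).
Proof.
move=> sM; rewrite /dot; under eq_bigr do rewrite mxE mulr_suml.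
rewrite exchange_big /=; apply: eq_bigr => j _; rewrite mxE mulr_sumr.
by apply: eq_bigr => i _; rewrite -{1}sM mxE; ring.
Qed.

Lemma trmx_exprn M k : M^T = M -> (M ^+ k)^T = M ^+ k.
Proof.
move=> sM; elim: k => [|k IH]; first by rewrite expr0 trmx1.
by rewrite {1}exprSr [in RHS]exprS -!mulmxE trmx_mul IH sM.
Qed.

(** By symmetry and Cauchy-Schwarz the norms of [M ^+ i *m v] are log-convex in [i]. Since the norm
    at [i = 0] is at most 1, each further power gains at least the factor [enorm (M *m v)]. *)
Lemma enorm_mulmxX M v k : M^T = M -> enorm v <= 1 ->
  enorm (M *m v) ^+ k.+1 <= enorm (M ^+ k.+1 *m v).
Proof.
move=> sM v1; pose a i := enorm (M ^+ i *m v).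
have a0 i : 0 <= a i := enorm_ge0 _.
have aSS i : a i.+1 ^+ 2 <= a i * a i.+2.
  rewrite sqr_enorm [X in dot X _](_ : _ = M *m (M ^+ i *m v)); last first.
    by rewrite mulmxA mulmxE -exprS.
  rewrite dot_sym //; apply: le_trans (dot_le_enorm _ _) _.
  by rewrite mulmxA mulmxE -exprS.
have aS i : a 1 * a i <= a i.+1.
  elim: i => [|i IH]; first by rewrite ler_piMr // /a expr0 mul1mx.
  have := a0 i.+1; rewrite le_eqVlt => /orP[/eqP<-|ai]; first by rewrite mulr0.
  have ai0 : 0 < a i.
    rewrite lt_neqAle a0 andbT; apply/eqP => ai0.
    by have := aSS i; rewrite -ai0 mul0r leNgt exprn_gt0.
  rewrite -(ler_pM2l ai0); apply: le_trans (aSS i).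
  by rewrite mulrCA mulrA (expr2 (a i.+1)) ler_wpM2r.
rewrite -[M in leLHS]expr1 -/(a 1) -/(a k.+1); elim: k => [//|k IH].
by rewrite exprS; apply: le_trans (aS k.+1); apply: ler_wpM2l.
Qed.

(** Without eigenvalues: the trace is the squared Frobenius norm of [M ^+ k], which controls the
    image of unit vectors under [M ^+ k], and [enorm_mulmxX] returns to [M]. *)
Lemma opnorm_exp_le_trace M k : M^T = M -> (0 < k)%N ->
  opnorm M ^+ (2 * k) <= \tr (M ^+ (2 * k)).
Proof.
case: k => // k sM _; set N := (2 * k.+1)%N.
have trE : \tr (M ^+ N) = \tr (M ^+ k.+1 *m (M ^+ k.+1)^T).
  by rewrite trmx_exprn // mulmxE -exprD addnn -mul2n.
have tr0 : 0 <= \tr (M ^+ N) by rewrite trE frobenius_ge0.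
(* Taking the [N]-th root of the trace allows the supremum to be bounded vector by vector. *)
have yN : (\tr (M ^+ N) `^ N%:R^-1) ^+ N = \tr (M ^+ N).
  by rewrite -powR_mulrn ?powR_ge0 // -powRrM mulVf ?pnatr_eq0 // powRr1.
rewrite -[leRHS]yN; apply: lerXn2r; rewrite ?nnegrE ?opnorm_ge0 ?powR_ge0 //.
apply: opnorm_le => v v1.
rewrite -(ler_pXn2r (_ : 0 < N)%N) ?nnegrE ?enorm_ge0 ?powR_ge0 // yN.
rewrite /N mulnC exprM; apply: (@le_trans _ _ (enorm (M ^+ k.+1 *m v) ^+ 2)).
  by apply: lerXn2r; rewrite ?nnegrE ?exprn_ge0 ?enorm_ge0 // enorm_mulmxX.
rewrite mulnC -/N trE; apply: le_trans (enorm_mulmx_frobenius _ _) _.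
by rewrite ler_piMr ?frobenius_ge0 // exprn_ile1 ?enorm_ge0.
Qed.

End EuclideanNorm.

(** * Jensen's inequality for powers and finite product laws *)

Lemma tangent_le_exprn (R : realFieldType) (a y : R) m : 0 <= a -> 0 <= y ->
  a ^+ m + m%:R * a ^+ m.-1 * (y - a) <= y ^+ m.
Proof.
move=> a0 y0; elim: m => [|m IH]; first by rewrite mul0r mul0r addr0.
have := ler_wpM2l y0 IH; rewrite -exprS; apply: le_trans.
(* Multiplying the induction hypothesis by [y] overshoots the next tangent line by a multiple of a
   square. *)
rewrite -subr_ge0 (_ : _ - _ = m%:R * a ^+ m.-1 * (y - a) ^+ 2).
  by rewrite mulr_ge0 ?sqr_ge0 // mulr_ge0 // exprn_ge0.
by case: m {IH} => [|m] /=; rewrite ?exprS -?natr1; ring.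
Qed.

Lemma Jensen_exprn (R : realFieldType) (I : finType) (p y : I -> R) m :
  (forall i, 0 <= p i) -> \sum_i p i = 1 -> (forall i, 0 <= y i) ->
  (\sum_i p i * y i) ^+ m <= \sum_i p i * y i ^+ m.
Proof.
move=> p0 p1 y0; set a := \sum_i _.
have a0 : 0 <= a by apply: sumr_ge0 => i _; rewrite mulr_ge0.
(* The tangent is taken at the mean [a], so its linear term averages to zero. *)
have : \sum_i p i * (a ^+ m + m%:R * a ^+ m.-1 * (y i - a)) <= \sum_i p i * y i ^+ m.
  by apply: ler_sum => i _; rewrite ler_wpM2l // tangent_le_exprn.
apply: le_trans; rewrite (_ : \sum_i _ = \sum_i p i * a ^+ m +
    m%:R * a ^+ m.-1 * (a - \sum_i p i * a)).
  by rewrite -!mulr_suml p1 !mul1r subrr mulr0 addr0.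
rewrite -sumrB mulr_sumr -big_split /=; apply: eq_bigr => i _; ring.
Qed.

Section ProdPmf.
Variables (R : realFieldType) (J K : finType) (mu : J -> K -> R).
Hypothesis mu_ge0 : forall j k, 0 <= mu j k.
Hypothesis mu1 : forall j, \sum_k mu j k = 1.

Lemma prod_pmf_ge0 w : 0 <= prod_pmf mu w.
Proof. exact: prodr_ge0. Qed.

Lemma prod_pmf1 : \sum_w prod_pmf mu w = 1.
Proof. by rewrite -(bigA_distr_bigA mu) big1. Qed.

Lemma prod_pmf_marginal j (f : K -> R) :
  \sum_w prod_pmf mu w * f (w j) = \sum_k mu j k * f k.
Proof.
pose g i k := mu i k * (if i == j then f k else 1).
transitivity (\prod_i \sum_k g i k).
  rewrite bigA_distr_bigA; apply: eq_bigr => w _; rewrite big_split /=; congr (_ * _).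
  by rewrite (bigD1 j) //= eqxx big1 ?mulr1 // => i /negbTE ->.
rewrite (bigD1 j) //= [X in _ * X]big1 ?mulr1.
  by apply: eq_bigr => k _; rewrite /g eqxx.
by move=> i /negbTE ij; rewrite /g ij; under eq_bigr do rewrite mulr1.
Qed.

End ProdPmf.

(** * The CUSUM statistic as a weighted sum over time *)

Section Cusum.
Variables (R : realType) (n T : nat).
Implicit Types (Y : 'I_T -> 'M[R]_n) (t : nat).

Definition cusum_weight t (s : 'I_T) : R :=
  Num.sqrt (t%:R * (T - t)%:R / T%:R) *
    (if (s < t)%N then t%:R^-1 else - (T - t)%:R^-1).

Lemma cusumE Y t : cusum Y t = \sum_s cusum_weight t s *: Y s.
Proof.
rewrite /cusum [RHS](bigID (fun s : 'I_T => (s < t)%N)) /= scalerBr !scalerA !scaler_sumr.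
congr (_ + _).
  by apply: eq_bigr => s st; rewrite /cusum_weight st.
rewrite -sumrN; apply: eq_big => [s|s ts]; first by rewrite -leqNgt.
by rewrite /cusum_weight ltnNge ts /= mulrN scaleNr.
Qed.

Lemma cusumB Y Y' t : cusum Y t - cusum Y' t = cusum (fun s => Y s - Y' s) t.
Proof. by rewrite !cusumE -sumrB; apply: eq_bigr => s _; rewrite scalerBr. Qed.

Lemma sum_ord_lt (V : nmodType) t (x : V) : (t <= T)%N ->
  \sum_(s < T | (s < t)%N) x = x *+ t.
Proof.
by move=> tT; rewrite -(big_ord_widen T (fun=> x)) // sumr_const card_ord.
Qed.

Lemma sum_ord_ge (V : zmodType) t (x : V) : (t <= T)%N ->
  \sum_(s < T | (t <= s)%N) x = x *+ (T - t).
Proof.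
move=> tT; apply: (addrI (x *+ t)); rewrite -mulrnDr subnKC //.
rewrite -{1}(sum_ord_lt x tT) [LHS](_ : _ = \sum_(s < T) x).
  by rewrite sumr_const card_ord.
rewrite [RHS](bigID (fun s : 'I_T => (s < t)%N)) /=; congr (_ + _).
by apply: eq_bigl => s; rewrite -leqNgt.
Qed.

(** The squared scaling [t (T - t) / T] is the inverse of [1/t + 1/(T - t)]. This normalization
    makes the variance bounds independent of [t] and [T]. *)
Lemma sum_sqr_cusum_weight t : (0 < t < T)%N -> \sum_s cusum_weight t s ^+ 2 = 1.
Proof.
move=> /andP[t0 tT]; have Tt : (0 < T - t)%N by rewrite subn_gt0.
have tn : t%:R != 0 :> R by rewrite pnatr_eq0 -lt0n.
have Ttn : (T - t)%:R != 0 :> R by rewrite pnatr_eq0 -lt0n.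
have Tn : T%:R != 0 :> R by rewrite pnatr_eq0 -lt0n (leq_trans _ tT).
have TE : T%:R = t%:R + (T - t)%:R :> R by rewrite -natrD subnKC // ltnW.
have c0 : 0 <= t%:R * (T - t)%:R / T%:R :> R by rewrite divr_ge0 ?mulr_ge0.
rewrite (bigID (fun s : 'I_T => (s < t)%N)) /=.
rewrite (eq_bigr (fun=> t%:R * (T - t)%:R / T%:R * t%:R^-2)); last first.
  by move=> s st; rewrite /cusum_weight st exprMn sqr_sqrtr // exprVn.
rewrite [X in _ + X](eq_bigr (fun=> t%:R * (T - t)%:R / T%:R * (T - t)%:R^-2)); last first.
  by move=> s /negbTE st; rewrite /cusum_weight st exprMn sqr_sqrtr // sqrrN exprVn.
have tT' := ltnW tT; rewrite (sum_ord_lt _ tT').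
rewrite [X in _ + X](eq_bigl (fun s : 'I_T => (t <= s)%N)); last first.
  by move=> s; rewrite -leqNgt.
rewrite (sum_ord_ge _ tT') -[X in X + _]mulr_natr -[X in _ + X]mulr_natr.
by move: Tn; rewrite TE => Tn; field; rewrite Tn tn Ttn.
Qed.

Lemma cusum_weight_le1 t s : (0 < t < T)%N -> `|cusum_weight t s| <= 1.
Proof.
move=> tT; rewrite -(ler_pXn2r (ltn0Sn 1)) ?nnegrE ?ler01 // expr1n real_normK ?num_real //.
rewrite -(sum_sqr_cusum_weight tT) (bigD1 s) //= lerDl.
by apply: sumr_ge0 => i _; exact: sqr_ge0.
Qed.

End Cusum.

(** * Edges of the graph as labels of walks *)

Section Edges.
Variables (R : realType) (n T : nat).

Definition end1 (j : 'I_T * edge n) : 'I_n := (val j.2).1.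
Definition end2 (j : 'I_T * edge n) : 'I_n := (val j.2).2.

Lemma end12 j : end1 j != end2 j.
Proof. by case: j => s [e /= h]; rewrite /end1 /end2 -(inj_eq val_inj) neq_ltn h. Qed.

(** Translates steps along labels into matrix entries. [edge_of] sorts the endpoints, whence the
    case analysis; on the diagonal both sides are false. *)
Lemma edge_ofE s (e : edge n) v u :
  incident end1 end2 (s, e) v && (other_end end1 end2 (s, e) v == u) = (edge_of v u == Some e).
Proof.
case: e => -[a b] /= ab; rewrite /incident /other_end /end1 /end2 /edge_of /=.
have nab : a != b by rewrite -(inj_eq val_inj) neq_ltn ab.
case: insubP => [e _ h | h]; rewrite ?(inj_eq Some_inj) -?[in RHS]val_eqE ?h /=.
  case: (v =P a) => [->|/eqP va]; last case: (v =P b) => [->|/eqP vb].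
  - case: ltnP => au; rewrite xpair_eqE ?eqxx /= 1?eq_sym // (negbTE nab) andbF.
    by apply/eqP => ub; move: au; rewrite ub leqNgt ab.
  - case: ltnP => bu; rewrite xpair_eqE ?eqxx /= 1?[a == u]eq_sym ?andbT //.
    rewrite [b == a]eq_sym (negbTE nab) /=; apply/eqP => ua.
    by have := ltn_trans ab bu; rewrite ua ltnn.
  - by case: ltnP => _; rewrite xpair_eqE /= ?(negbTE va) ?(negbTE vb) ?andbF.
case: (v =P a) h => [->|_]; last case: (v =P b) => [->|//].
  by move=> h; apply/eqP => bu; move: h; rewrite -bu ab /= ab.
by move=> h; apply/eqP => au; move: h; rewrite -au [(b < a)%N]ltnNge (ltnW ab) /= ab.
Qed.

Lemma sum_edge_of s (f : edge n -> R) v u :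
  \sum_(e | incident end1 end2 (s, e) v && (other_end end1 end2 (s, e) v == u)) f e =
  if edge_of v u is Some e then f e else 0.
Proof.
under eq_bigl do rewrite edge_ofE.
case: edge_of => [e|]; last by rewrite big_pred0.
by rewrite (big_pred1 e) // => e'; rewrite /= (inj_eq Some_inj) eq_sym.
Qed.

Lemma edge_of_val (v u : 'I_n) (e : edge n) : edge_of v u = Some e ->
  val e = (v, u) \/ val e = (u, v).
Proof.
by rewrite /edge_of; case: insubP => // e' _ h [<-]; rewrite h; case: ltnP; [left|right].
Qed.

Lemma edge_of_neq (v u : 'I_n) : v != u -> exists e, edge_of v u = Some e.
Proof.
move=> vu; rewrite /edge_of; case: insubP => [e|]; first by exists e.
by case: (ltngtP v u) => [/= ->|/= ->|/val_inj uv] //; rewrite uv eqxx in vu.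
Qed.

End Edges.

(** * Concentration of the CUSUM statistic *)

Lemma sum_label_pair (R : realType) n T (F : 'I_T * edge n -> R) v u :
  \sum_(j | incident (@end1 n T) (@end2 n T) j v && (other_end (@end1 n T) (@end2 n T) j v == u)) F j =
  \sum_s (if edge_of v u is Some e then F (s, e) else 0).
Proof.
under [RHS]eq_bigr => s _ do rewrite -(sum_edge_of s (fun e => F (s, e)) v u).
by rewrite pair_big_dep /=; apply: eq_big => [[s e]|[s e] _].
Qed.

Section Concentration.
Variables (R : realType) (n T : nat) (Theta : 'I_T -> 'M[R]_n) (Pi : 'M[R]_n).
Variables (omega : R) (t : nat).
Hypothesis omega_gt0 : 0 < omega.
Hypothesis tT : (0 < t < T)%N.
Hypothesis ThetaPi : forall s, Sn omega (Theta s, Pi).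

(** Written so that [sample_pmf Theta Pi] is convertible to [prod_pmf coord_pmf]. *)
Definition coord_pmf (j : 'I_T * edge n) (k : bool * bool) : R :=
  bernoulli_pmf (Theta j.1 (end1 j) (end2 j)) k.1 * bernoulli_pmf (Pi (end1 j) (end2 j)) k.2.

Definition link (k : bool * bool) : R := (k.2 && k.1)%:R.

Definition cusum_mean : 'M[R]_n := cusum (fun s => hadamard Pi (Theta s)) t.

Lemma T_gt0 : (0 < T)%N. Proof. by case/andP: tT => _; apply: leq_ltn_trans. Qed.

Lemma Theta_itv s i j : 0 <= Theta s i j <= 1.
Proof. by have [[[_ h] _] _ _ _] := ThetaPi s; exact: h. Qed.

Lemma Pi_itv i j : 0 <= Pi i j <= 1.
Proof. by have [_ [_ h] _ _] := ThetaPi (Ordinal T_gt0); exact: h. Qed.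

Lemma hadamard_sym s i j : hadamard Pi (Theta s) i j = hadamard Pi (Theta s) j i.
Proof.
have [[[/= /matrixP hT _] _] [/= /matrixP hP _] _ _] := ThetaPi s.
by have := hT i j; have := hP i j; rewrite !mxE => -> ->.
Qed.

Lemma hadamard_ge0 s i j : 0 <= hadamard Pi (Theta s) i j.
Proof. by rewrite mxE mulr_ge0 //; [case/andP: (Pi_itv i j)|case/andP: (Theta_itv s i j)]. Qed.

Lemma hadamard_le1 s i j : hadamard Pi (Theta s) i j <= 1.
Proof.
have /andP[p0 p1] := Pi_itv i j; have /andP[h0 h1] := Theta_itv s i j.
by rewrite mxE mulr_ile1.
Qed.

Lemma hadamard_row_le s v : \sum_u hadamard Pi (Theta s) v u <= omega.
Proof.
have [_ _ h _] := ThetaPi s; apply: le_trans h; rewrite /norm1oo /=.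
apply: le_trans (le_bigmax _ (fun j => \sum_(i < n) `|hadamard Pi (Theta s) i j|) v).
apply: ler_sum => u _.
by rewrite hadamard_sym ler_norm.
Qed.

Lemma coord_pmf_ge0 j k : 0 <= coord_pmf j k.
Proof. by rewrite mulr_ge0 ?bernoulli_pmf_ge0 ?Theta_itv ?Pi_itv. Qed.

Lemma coord_pmf1 j : \sum_k coord_pmf j k = 1.
Proof.
rewrite -(pair_bigA _ (fun a b => bernoulli_pmf _ a * bernoulli_pmf _ b)) /=.
by rewrite !big_bool /= /bernoulli_pmf; ring.
Qed.

Lemma coord_link j : \sum_k coord_pmf j k * link k = hadamard Pi (Theta j.1) (end1 j) (end2 j).
Proof.
rewrite mxE -(pair_bigA _ (fun a b => bernoulli_pmf _ a * bernoulli_pmf _ b * (b && a)%:R)) /=.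
by rewrite !big_bool /= /bernoulli_pmf; ring.
Qed.

Lemma obs_mean s :
  \sum_w sample_pmf Theta Pi w *: obs w s = hadamard Pi (Theta s).
Proof.
apply/matrixP => v u; rewrite summxE; have [->|vu] := eqVneq v u.
  have [[_ d] _ _ _] := ThetaPi s; rewrite [RHS]mxE d mulr0 big1 // => w _.
  by rewrite !mxE /edge_of ltnn insubF ?mulr0 //= ltnn.
have [e vue] := edge_of_neq vu.
transitivity (\sum_w prod_pmf coord_pmf w * link (w (s, e))).
  by apply: eq_bigr => w _; rewrite !mxE vue.
rewrite prod_pmf_marginal; last exact: coord_pmf1.
rewrite coord_link /end1 /end2 /=; have [->|->] := edge_of_val vue => //=.
exact: hadamard_sym.
Qed.

Lemma cusum_obs_mean :
  \sum_w sample_pmf Theta Pi w *: cusum (obs w) t = cusum_mean.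
Proof.
rewrite /cusum_mean !cusumE; under eq_bigr do rewrite cusumE scaler_sumr.
rewrite exchange_big /=; apply: eq_bigr => s _; rewrite -obs_mean scaler_sumr.
by apply: eq_bigr => w _; rewrite !scalerA mulrC.
Qed.

Definition link_diff (j : 'I_T * edge n) (k k' : bool * bool) : R :=
  cusum_weight R t j.1 * (link k - link k').

Lemma cusum_obsB w w' : cusum (obs w) t - cusum (obs w') t =
  label_mx (@end1 n T) (@end2 n T) (fun j => link_diff j (w j) (w' j)).
Proof.
rewrite cusumB cusumE; apply/matrixP => v u; rewrite summxE [RHS]mxE.
rewrite sum_label_pair.
apply: eq_bigr => s _; rewrite !mxE; case: edge_of => [e|] //.
by rewrite subrr mulr0.
Qed.

Definition label_var (j : 'I_T * edge n) : R :=
  2 * cusum_weight R t j.1 ^+ 2 * hadamard Pi (Theta j.1) (end1 j) (end2 j).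

(** For 0-1 values, [(x - y) ^+ 2 <= x + y], whose expectation is twice the link probability. *)
Lemma moment2_link_diff j : moment coord_pmf link_diff j 2 <= label_var j.
Proof.
have -> : label_var j = \sum_k \sum_k' coord_pmf j k * coord_pmf j k' *
    (cusum_weight R t j.1 ^+ 2 * (link k + link k')).
  transitivity (cusum_weight R t j.1 ^+ 2 *
      (\sum_k \sum_k' (coord_pmf j k * link k * coord_pmf j k'
                       + coord_pmf j k * (coord_pmf j k' * link k')))).
    under eq_bigr do rewrite big_split /= -!mulr_sumr coord_link coord_pmf1 mulr1.
    by rewrite big_split /= -mulr_suml coord_pmf1 coord_link /label_var; ring.
  rewrite mulr_sumr; apply: eq_bigr => k _; rewrite mulr_sumr; apply: eq_bigr => k' _.
  by ring.
apply: ler_sum => k _; apply: ler_sum => k' _.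
apply: ler_wpM2l; first by rewrite mulr_ge0 ?coord_pmf_ge0.
rewrite exprMn ler_wpM2l ?sqr_ge0 // /link.
by case: (_ && _); case: (_ && _); rewrite /=; lra.
Qed.

Lemma label_var_pair v u : \sum_(j | incident (@end1 n T) (@end2 n T) j v
    && (other_end (@end1 n T) (@end2 n T) j v == u)) label_var j <=
  \sum_s 2 * cusum_weight R t s ^+ 2 * hadamard Pi (Theta s) v u.
Proof.
rewrite sum_label_pair.
apply: ler_sum => s _; case vue : edge_of => [e|].
  rewrite /label_var /end1 /end2 /=; have [->|->] //= := edge_of_val vue.
  by rewrite hadamard_sym.
by rewrite mulr_ge0 ?hadamard_ge0 // mulr_ge0 ?sqr_ge0.
Qed.

Lemma label_var_pair_le v u : \sum_(j | incident (@end1 n T) (@end2 n T) j v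
    && (other_end (@end1 n T) (@end2 n T) j v == u)) label_var j <= 2.
Proof.
apply: le_trans (label_var_pair v u) _.
apply: (@le_trans _ _ (\sum_(s < T) 2 * cusum_weight R t s ^+ 2)); last first.
  by rewrite -mulr_sumr (sum_sqr_cusum_weight R tT) mulr1.
apply: ler_sum => s _.
have c0 : 0 <= 2 * cusum_weight R t s ^+ 2 by rewrite mulr_ge0 ?sqr_ge0.
by apply: ler_piMr => //; exact: hadamard_le1.
Qed.

Lemma label_var_inc_le v :
  \sum_(j | incident (@end1 n T) (@end2 n T) j v) label_var j <= 2 * omega.
Proof.
rewrite (partition_big (fun j => other_end (@end1 n T) (@end2 n T) j v) predT) //=.
apply: (@le_trans _ _
  (\sum_u \sum_(s < T) 2 * cusum_weight R t s ^+ 2 * hadamard Pi (Theta s) v u)).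
  by apply: ler_sum => u _; exact: label_var_pair.
rewrite exchange_big /=.
have -> : 2 * omega = \sum_(s < T) 2 * cusum_weight R t s ^+ 2 * omega.
  by rewrite -mulr_suml -mulr_sumr sum_sqr_cusum_weight // mulr1.
apply: ler_sum => s _; rewrite -mulr_sumr ler_wpM2l //; first by rewrite mulr_ge0 ?sqr_ge0.
exact: hadamard_row_le.
Qed.

Lemma cusum_obsB_sym (w w' : sample n T) :
  (cusum (obs w) t - cusum (obs w') t : 'M[R]_n)^T = cusum (obs w) t - cusum (obs w') t.
Proof.
rewrite cusumB cusumE; apply/matrixP => i j; rewrite mxE !summxE; apply: eq_bigr => s _.
by rewrite !mxE /edge_of; case: (ltngtP i j) => [//|//|/val_inj ->].
Qed.

Lemma opnorm_cusum_moment k : (0 < k)%N ->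
  \sum_w sample_pmf Theta Pi w * opnorm (cusum (obs w) t - cusum_mean) ^+ (2 * k)
  <= n%:R * (2 * Num.sqrt (2 * omega + 5 * (2 * k)%:R ^+ 2)) ^+ (2 * k).
Proof.
move=> k0; set N := (2 * k)%N; set s := Num.sqrt _.
have N0 : (0 < N)%N by rewrite muln_gt0.
have S0 : 0 < 2 * omega + 5 * N%:R ^+ 2.
  by rewrite ltr_wpDr ?mulr_gt0 // mulr_ge0 ?exprn_ge0.
have s0 : 0 < s by rewrite sqrtr_gt0.
have pmf0 w : 0 <= sample_pmf Theta Pi w by exact: prod_pmf_ge0 coord_pmf_ge0 w.
have pmf1 : \sum_w sample_pmf Theta Pi w = 1 by exact: prod_pmf1 coord_pmf1.
apply: le_trans (expect2_trace_le (@end12 n T) coord_pmf_ge0 coord_pmf1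
  (eta := link_diff) _ _ N0 moment2_link_diff label_var_inc_le label_var_pair_le s0 _); last 3 first.
- by move=> j x x'; rewrite /link_diff; ring.
- move=> j x x'; rewrite normrM mulr_ile1 ?cusum_weight_le1 // /link.
  by case: (_ && _); case: (_ && _); rewrite /= ?subrr ?normr0 ?subr0 ?sub0r ?normrN ?normr1.
(* The 5 is [1 + 2 * kappa] with [kappa = 2], from [label_var_pair_le]. *)
- by rewrite sqr_sqrtr ?(ltW S0) // (_ : 1 + 2 * 2 = 5) //; ring.
apply: ler_sum => w _; under [leRHS]eq_bigr do rewrite -mulrA.
rewrite -mulr_sumr; apply: ler_wpM2l => //.
(* Symmetrization: the centred statistic is the average of its differences with an independent
   copy. *)
have -> : cusum (obs w) t - cusum_mean =
    \sum_w' sample_pmf Theta Pi w' *: (cusum (obs w) t - cusum (obs w') t).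
  under eq_bigr do rewrite scalerBr.
  by rewrite sumrB cusum_obs_mean -scaler_suml pmf1 scale1r.
apply: (@le_trans _ _
  ((\sum_w' sample_pmf Theta Pi w' * opnorm (cusum (obs w) t - cusum (obs w') t)) ^+ N)).
  apply: lerXn2r; rewrite ?nnegrE ?opnorm_ge0 //.
    by apply: sumr_ge0 => w' _; rewrite mulr_ge0 ?opnorm_ge0.
  apply: le_trans (opnorm_sum _) _; apply: ler_sum => w' _.
  by apply: le_trans (opnormZ_le _ _) _; rewrite ger0_norm.
apply: le_trans (Jensen_exprn N pmf0 pmf1 (fun w' => opnorm_ge0 _)) _.
apply: ler_sum => w' _; apply: ler_wpM2l => //.
by rewrite -cusum_obsB; apply: opnorm_exp_le_trace k0; exact: cusum_obsB_sym.
Qed.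

Definition tail_level (eps L : R) :=
  2 * Num.sqrt 2 * (1 + eps) * Num.sqrt omega + 36 / eps * L.

Lemma cusum_tail eps L : 0 < eps -> eps <= 1 / 2 -> 1 <= L ->
  IRGML_prob Theta Pi (fun Y => tail_level eps L <= opnorm (cusum Y t - cusum_mean))
  <= n%:R * expR (- L).
Proof.
move=> e0 e1 L1; set H := tail_level eps L.
have eL1 : 1 <= L / eps by rewrite ler_pdivlMr // mul1r; lra.
(* [k] exceeds [L / eps] so that [(1 + eps) ^+ (2 * k)] beats [expR L], yet by at most 1 so that [N]
   stays of order [L / eps]. *)
pose k := (Num.truncn (L / eps)).+1; pose N := (2 * k)%N.
have kL : k%:R <= L / eps + 1 :> R.
  by rewrite -natr1 lerD2r truncn_le // (le_trans _ eL1).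
have Lk : L <= eps * k%:R by rewrite -ler_pdivrMl // mulrC ltW // truncnS_gt.
have k1 : 1 <= k%:R :> R by rewrite ler1n.
have NE : N%:R = 2 * k%:R :> R by rewrite natrM.
set s := Num.sqrt (2 * omega + 5 * N%:R ^+ 2).
have s0 : 0 <= s := sqrtr_ge0 _.
have o0 := sqrtr_ge0 omega; have r0 := sqrtr_ge0 (2 : R).
have ro0 : 0 <= Num.sqrt 2 * Num.sqrt omega by rewrite mulr_ge0.
(* Squaring suffices: [5 <= 3 ^+ 2] and the cross term is nonnegative. *)
have s_le : s <= Num.sqrt 2 * Num.sqrt omega + 3 * N%:R.
  have N0 : 0 <= N%:R :> R by [].
  rewrite -(ler_pXn2r (ltn0Sn 1)) ?nnegrE ?addr_ge0 ?mulr_ge0 //.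
  rewrite sqr_sqrtr; last by rewrite addr_ge0 ?mulr_ge0 ?sqr_ge0 // ltW.
  rewrite sqrrD exprMn !sqr_sqrtr ?(ltW omega_gt0) // exprMn.
  have : 0 <= Num.sqrt 2 * Num.sqrt omega * (3 * N%:R) by rewrite !mulr_ge0.
  have := sqr_ge0 (N%:R : R); rewrite mulr2n; lra.
have eps1 : 0 < 1 + eps by lra.
(* Source of 36: [12 * (1 + eps) * k <= 18 * k], and [k <= L / eps + 1 <= 2 * (L / eps)]. *)
have Hs : (1 + eps) * (2 * s) <= H.
  have h1 : (1 + eps) * (2 * s) <= (1 + eps) * (2 * (Num.sqrt 2 * Num.sqrt omega + 3 * N%:R)).
    by rewrite ler_pM2l // ler_pM2l.
  apply: le_trans h1 _; rewrite /H /tail_level NE.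
  have h2 : eps * k%:R <= 1 / 2 * k%:R by rewrite ler_wpM2r.
  have -> : 36 / eps * L = 36 * (L / eps) by ring.
  have -> : (1 + eps) * (2 * (Num.sqrt 2 * Num.sqrt omega + 3 * (2 * k%:R))) =
    2 * Num.sqrt 2 * (1 + eps) * Num.sqrt omega + 12 * k%:R + 12 * (eps * k%:R) by ring.
  lra.
have H0 : 0 < H.
  have L0 : 0 < L by lra.
  have H2 : 0 < 36 / eps * L by rewrite mulr_gt0 ?divr_gt0.
  rewrite /H /tail_level; apply: ltr_wpDl H2.
  by rewrite mulr_ge0 // mulr_ge0 ?(ltW eps1) // mulr_ge0.
have HN0 : 0 < H ^+ N by rewrite exprn_gt0.
have pmf0 w : 0 <= sample_pmf Theta Pi w by exact: prod_pmf_ge0 coord_pmf_ge0 w.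
have markov : IRGML_prob Theta Pi (fun Y => H <= opnorm (cusum Y t - cusum_mean)) * H ^+ N
   <= n%:R * (2 * s) ^+ N.
  apply: le_trans (opnorm_cusum_moment (ltn0Sn _)).
  rewrite /IRGML_prob mulr_suml big_mkcond /=; apply: ler_sum => w _; case: ifP => h.
    by rewrite ler_wpM2l // lerXn2r // nnegrE ?opnorm_ge0 // ltW.
  by rewrite mulr_ge0 // exprn_ge0 ?opnorm_ge0.
rewrite -(ler_pM2r HN0); apply: le_trans markov _; rewrite -mulrA ler_wpM2l //.
apply: (@le_trans _ _ (expR (- L) * ((1 + eps) * (2 * s)) ^+ N)); last first.
  rewrite ler_pM2l ?expR_gt0 // lerXn2r // nnegrE ?(ltW H0) //.
  by rewrite !mulr_ge0 // ltW.
rewrite [X in _ <= _ * X]exprMn mulrA ler_peMl //; first by rewrite exprn_ge0 // mulr_ge0.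
(* It remains to see that [(1 + eps) ^+ N >= expR L]. As [N = 2 * k] and [eps * k >= L], the bound
   [expR (eps / 2) <= 1 + eps] is enough; it follows from [(1 + eps) * (1 - eps / 2) >= 1]. *)
have base : expR (eps / 2) <= 1 + eps.
  have h1 : 1 - eps / 2 <= expR (- (eps / 2)) by exact: expR_ge1Dx.
  have h2 : 0 < expR (- (eps / 2)) := expR_gt0 _.
  rewrite -(ler_pM2r h2) -expRD subrr expR0.
  apply: (@le_trans _ _ ((1 + eps) * (1 - eps / 2))); last by rewrite ler_pM2l.
  have : eps ^+ 2 <= eps * (1 / 2) by rewrite expr2 ler_pM2l.
  have -> : (1 + eps) * (1 - eps / 2) = 1 + eps / 2 - eps ^+ 2 / 2 by field.
  lra.
apply: (@le_trans _ _ (expR (- L) * expR (eps / 2) ^+ N)).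
  rewrite -expRM_natl -expRD -[leLHS]expR0 ler_expR NE; lra.
by rewrite ler_pM2l ?expR_gt0 // lerXn2r // nnegrE ?expR_ge0 // ltW.
Qed.

End Concentration.

(** * Mean of the CUSUM statistic and the dyadic grid *)

Section CusumShift.
Variables (R : realType) (n T t tau : nat).
Hypothesis tT : (0 < t < T)%N.
Hypothesis tauT : (0 < tau < T)%N.

Let c : R := Num.sqrt (t%:R * (T - t)%:R / T%:R).

(** The coefficient with which a jump at [tau] enters the mean of the CUSUM matrix at [t]. *)
Definition shift_weight : R := \sum_(s < T | (s < tau)%N) cusum_weight R t s.

Lemma sum_cusum_weight : \sum_(s < T) cusum_weight R t s = 0.
Proof.
have /andP[t0 ltT] := tT.
have tn : t%:R != 0 :> R by rewrite pnatr_eq0 -lt0n.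
have Ttn : (T - t)%:R != 0 :> R by rewrite pnatr_eq0 -lt0n subn_gt0.
rewrite (bigID (fun s : 'I_T => (s < t)%N)) /=.
rewrite (eq_bigr (fun=> c / t%:R)); last by move=> s st; rewrite /cusum_weight st.
rewrite [X in _ + X](eq_bigr (fun=> - (c / (T - t)%:R))); last first.
  by move=> s /negbTE st; rewrite /cusum_weight st mulrN.
rewrite (sum_ord_lt _ (ltnW ltT)).
rewrite [X in _ + X](eq_bigl (fun s : 'I_T => (t <= s)%N)); last first.
  by move=> s; rewrite -leqNgt.
rewrite (sum_ord_ge _ (ltnW ltT)) -[X in X + _]mulr_natr -[X in _ + X]mulr_natr.
by field; rewrite tn Ttn.
Qed.

Lemma shift_weight_early : (tau <= t)%N -> shift_weight = c * tau%:R / t%:R.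
Proof.
move=> tau_t; have /andP[_ ltT] := tauT.
rewrite /shift_weight (eq_bigr (fun=> c / t%:R)); last first.
  by move=> s st; rewrite /cusum_weight (leq_trans st).
by rewrite (sum_ord_lt _ (ltnW ltT)) -[LHS]mulr_natr mulrAC.
Qed.

Lemma shift_weight_late : (t <= tau)%N -> shift_weight = c * (T - tau)%:R / (T - t)%:R.
Proof.
move=> t_tau; have /andP[_ ltT] := tauT.
(* As all weights sum to zero, the sum before [tau] is read off from the times after [tau], where
   the weight is constant. *)
have := sum_cusum_weight; rewrite (bigID (fun s : 'I_T => (s < tau)%N)) /= -/shift_weight.
rewrite [X in _ + X](eq_bigl (fun s : 'I_T => (tau <= s)%N)); last first.
  by move=> s; rewrite -leqNgt.
rewrite [X in _ + X](eq_bigr (fun=> - (c / (T - t)%:R))); last first.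
  by move=> s st; rewrite /cusum_weight ltnNge (leq_trans t_tau st) /= mulrN.
rewrite (sum_ord_ge _ (ltnW ltT)) -mulr_natr => /eqP; rewrite addr_eq0 => /eqP ->.
by ring.
Qed.

Lemma cusum_shift (A B : 'M[R]_n) :
  cusum (fun s : 'I_T => if (s < tau)%N then A else B) t = shift_weight *: (A - B).
Proof.
rewrite cusumE [LHS](_ : _ = \sum_(s < T) cusum_weight R t s *: B
   + \sum_(s < T | (s < tau)%N) cusum_weight R t s *: (A - B)).
  by rewrite -!scaler_suml sum_cusum_weight scale0r add0r.
rewrite [X in _ + X]big_mkcond -big_split /=; apply: eq_bigr => s _.
by case: ifP => _; rewrite ?addr0 // -scalerDr addrC subrK.
Qed.

End CusumShift.

Section Grid.
Variables (R : realType) (T : nat).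
Hypothesis T2 : (2 <= T)%N.

Let K := Num.truncn (log2 (T%:R / 2) : R).

Lemma ln2_gt0 : 0 < ln 2 :> R.
Proof. by rewrite ln_gt0 // ltr1n. Qed.

Lemma log2_half_ge0 : 0 <= log2 (T%:R / 2) :> R.
Proof.
apply: divr_ge0 (ltW ln2_gt0); apply: ln_ge0.
by rewrite ler_pdivlMr // mul1r ler_nat.
Qed.

(** Replaces the real logarithm in the grid by an inequality between integers. *)
Lemma leq_truncn_log2 k : (k <= K)%N = (2 * 2 ^ k <= T)%N.
Proof.
have h0 : 0 < T%:R / 2 :> R by rewrite divr_gt0 // ltr0n (leq_trans _ T2).
rewrite truncn_ge_nat ?log2_half_ge0 // /log2 ler_pdivlMr ?ln2_gt0 //.
rewrite [X in X <= _]mulr_natl -lnXn // ler_ln ?posrE ?exprn_gt0 // ler_pdivlMr //.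
by rewrite -natrX -natrM ler_nat mulnC.
Qed.

Lemma mem_dyadic_gridl k : (2 * 2 ^ k <= T)%N -> (2 ^ k)%N \in dyadic_grid R T.
Proof.
rewrite -leq_truncn_log2 => kK; rewrite mem_cat map_f //.
by rewrite mem_iota add0n /= ltnS.
Qed.

Lemma mem_dyadic_gridr k : (2 * 2 ^ k <= T)%N -> (T - 2 ^ k)%N \in dyadic_grid R T.
Proof.
rewrite -leq_truncn_log2 => kK; rewrite mem_cat orbC.
by rewrite (map_f (fun k => T - 2 ^ k)%N) // mem_iota add0n /= ltnS.
Qed.

Lemma dyadic_grid_itv t : t \in dyadic_grid R T -> (0 < t < T)%N.
Proof.
rewrite mem_cat => /orP[] /mapP[k]; rewrite mem_iota add0n ltnS leq_truncn_log2 => h ->;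
  have := expn_gt0 2 k; lia.
Qed.

Lemma log2_ge1 : 1 <= log2 T%:R :> R.
Proof.
rewrite /log2 ler_pdivlMr ?ln2_gt0 // mul1r ler_ln ?posrE ?ltr0n ?ler_nat //.
exact: leq_trans T2.
Qed.

Lemma size_dyadic_grid : (size (dyadic_grid R T))%:R <= 2 * log2 T%:R :> R.
Proof.
rewrite size_cat !size_map !size_iota -/K addnn -mul2n natrM ler_pM2l //.
rewrite -natr1 -lerBrDr.
have -> : log2 T%:R - 1 = log2 (T%:R / 2) :> R.
  rewrite /log2 ln_div ?posrE ?ltr0n ?(leq_trans _ T2) // mulrBl divff //.
  by rewrite gt_eqF // ln2_gt0.
by rewrite truncn_le // log2_half_ge0.
Qed.

End Grid.

Lemma dyadic_close tau : (0 < tau)%N -> exists k, (2 ^ k <= tau < 2 * 2 ^ k)%N.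
Proof.
move=> t0; exists (trunc_log 2 tau); rewrite -expnS.
by have := trunc_log_bounds (ltnSn 1) t0.
Qed.

Lemma shift_ratio (R : realFieldType) (T u x : R) : 0 < u -> u <= x -> x <= 2 * u ->
  2 * x <= T -> x * (T - x) / T <= 3 * (u / (T * (T - u)) * (T - x) ^+ 2).
Proof.
move=> u0 ux xu xT; have T0 : 0 < T by lra.
have Tu : 0 < T - u by lra.
have Tx : 0 < T - x by lra.
rewrite -(ler_pM2r T0) -(ler_pM2r Tu).
have -> : x * (T - x) / T * T * (T - u) = (T - x) * (x * (T - u)).
  by field; rewrite gt_eqF.
have -> : 3 * (u / (T * (T - u)) * (T - x) ^+ 2) * T * (T - u) = (T - x) * (3 * u * (T - x)).
  by field; rewrite !gt_eqF.
(* What remains amounts to [x * T + 2 * u * x <= 3 * u * T], the sum of [x * T <= 2 * u * T] and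
   [2 * x * u <= T * u]. *)
rewrite ler_pM2l //; nra.
Qed.

(** The grid point lies at distance [u] from the end of the time range nearest to [tau], where [u]
    is the largest power of 2 not exceeding the distance of [tau] from that end. Losing at most a
    factor 2 in this distance costs the factor [Num.sqrt 3]. *)
Lemma shift_weight_grid (R : realType) T tau : (2 <= T)%N -> (0 < tau < T)%N ->
  exists2 t, t \in dyadic_grid R T &
    0 < shift_weight R T t tau /\
    Num.sqrt T%:R * q (tau%:R / T%:R) <= Num.sqrt 3 * shift_weight R T t tau.
Proof.
move=> T2 tauT; have /andP[tau0 ltT] := tauT.
have T0 : 0 < T%:R :> R by rewrite ltr0n (leq_trans _ T2).
have qE : Num.sqrt T%:R * q (tau%:R / T%:R) =
    Num.sqrt (tau%:R * (T%:R - tau%:R) / T%:R) :> R.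
  rewrite /q -sqrtrM ?ltW //; congr (Num.sqrt _); field; by rewrite gt_eqF.
suff : exists2 t, t \in dyadic_grid R T & 0 < shift_weight R T t tau /\
    tau%:R * (T%:R - tau%:R) / T%:R <= 3 * shift_weight R T t tau ^+ 2.
  case=> t tg [w0 h]; exists t => //; split => //.
  rewrite qE -[X in _ <= _ * X]ger0_norm ?(ltW w0) // -sqrtr_sqr -sqrtrM //.
  by rewrite ler_wsqrtr.
have natB a : (a <= T)%N -> (T - a)%:R = T%:R - a%:R :> R by move=> ?; rewrite natrB.
have [h2|h2] := leqP (2 * tau) T.
  have [k /andP[k1 k2]] := dyadic_close tau0; have u0 := expn_gt0 2 k.
  exists (2 ^ k)%N; first by apply: mem_dyadic_gridl => //; lia.
  set u := (2 ^ k)%N in k1 k2 u0 *.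
  have uT : (0 < u < T)%N by lia.
  have uR : 0 < u%:R :> R by rewrite ltr0n.
  have TuR : 0 < T%:R - u%:R :> R by rewrite subr_gt0 ltr_nat; lia.
  have TtR : 0 < T%:R - tau%:R :> R by rewrite subr_gt0 ltr_nat; lia.
  rewrite shift_weight_late // !natB; [|lia..].
  have c0 : 0 < u%:R * (T%:R - u%:R) / T%:R :> R by rewrite divr_gt0 // mulr_gt0.
  split; first by rewrite divr_gt0 // mulr_gt0 // sqrtr_gt0.
  rewrite exprMn exprMn sqr_sqrtr ?(ltW c0) //.
  apply: le_trans (shift_ratio uR _ _ _) _; rewrite ?ler_nat -?natrM ?ler_nat; [lia..|].
  rewrite le_eqVlt; apply/orP; left; apply/eqP; field.
  by rewrite !gt_eqF.
(* Mirror image of the first case, with [T - tau] in place of [tau]. *)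
have tau'0 : (0 < T - tau)%N by lia.
have [k /andP[k1 k2]] := dyadic_close tau'0; have u0 := expn_gt0 2 k.
exists (T - 2 ^ k)%N; first by apply: mem_dyadic_gridr => //; lia.
set u := (2 ^ k)%N in k1 k2 u0 *.
have uT : (0 < T - u < T)%N by lia.
have uR : 0 < u%:R :> R by rewrite ltr0n.
have TuR : 0 < T%:R - u%:R :> R by rewrite subr_gt0 ltr_nat; lia.
have tauR : 0 < tau%:R :> R by rewrite ltr0n.
rewrite shift_weight_early //; last by lia.
rewrite (_ : T - (T - u) = u)%N; last by lia.
rewrite !natB; last by lia.
have c0 : 0 < (T%:R - u%:R) * u%:R / T%:R :> R by rewrite divr_gt0 // mulr_gt0.
split; first by rewrite divr_gt0 // mulr_gt0 // sqrtr_gt0.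
rewrite exprMn exprMn sqr_sqrtr ?(ltW c0) //.
have /le_trans -> // : tau%:R * (T%:R - tau%:R) / T%:R <=
    3 * (u%:R / (T%:R * (T%:R - u%:R)) * (T%:R - (T - tau)%:R) ^+ 2) :> R.
  apply: le_trans (shift_ratio (x := (T - tau)%:R) uR _ _ _).
  - by rewrite natB 1?ltnW // le_eqVlt; apply/orP; left; apply/eqP; ring.
  - by rewrite ler_nat.
  - by rewrite -natrM ler_nat ltnW.
  - by rewrite -natrM ler_nat; lia.
rewrite natB 1?ltnW // le_eqVlt; apply/orP; left; apply/eqP; field.
by rewrite !gt_eqF.
Qed.

(** * Union bound and the mean under each hypothesis *)

Lemma sup_le_nonneg (R : realType) (A : set R) a : 0 <= a -> (forall x, A x -> x <= a) ->
  sup A <= a.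
Proof.
(* The empty set has [sup] equal to 0, which is where [0 <= a] enters. *)
move=> a0 h; have [->|/set0P An0] := eqVneq A set0; first by rewrite sup0.
exact: ge_sup.
Qed.

Lemma IRGML_prob_has (R : realType) n T (Theta : 'I_T -> 'M[R]_n) Pi
    (I : Type) (s : seq I) (E : ('I_T -> 'M[R]_n) -> bool)
    (F : I -> ('I_T -> 'M[R]_n) -> bool) :
  (forall w, 0 <= sample_pmf Theta Pi w) ->
  (forall Y, E Y -> has (fun i => F i Y) s) ->
  IRGML_prob Theta Pi E <= \sum_(i <- s) IRGML_prob Theta Pi (F i).
Proof.
move=> p0 h; rewrite /IRGML_prob big_mkcond /=.
rewrite [leRHS](eq_bigr (fun i => \sum_w (F i (obs w))%:R * sample_pmf Theta Pi w)); last first.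
  move=> i _; rewrite big_mkcond /=; apply: eq_bigr => w _.
  by case: (F i _); rewrite ?mul1r ?mul0r.
rewrite exchange_big /=; apply: ler_sum => w _; rewrite -mulr_suml.
have S0 (s' : seq I) : 0 <= \sum_(i <- s') (F i (obs w))%:R :> R by apply: sumr_ge0.
case: ifP => [/h|_]; last by rewrite mulr_ge0.
move=> hs; rewrite ler_peMl //; elim: s hs {h} => //= i s IH /orP[Fi|/IH le1].
  by rewrite big_cons Fi lerDl.
by rewrite big_cons (le_trans le1) // lerDr.
Qed.

Lemma ln_ge1 (R : realType) (x : R) : 4 <= x -> 1 <= ln x.
Proof.
move=> x4; rewrite -[leLHS]expRK ler_ln ?posrE ?expR_gt0 //; last by lra.
apply: le_trans x4.
(* The bound [expR 1 <= 4] comes from squaring this one, itself the inverse of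
   [1 - 1 / 2 <= expR (- (1 / 2))]. *)
have h : expR (1 / 2) <= 2 :> R.
  have h1 : 1 - 1 / 2 <= expR (- (1 / 2)) :> R by exact: expR_ge1Dx.
  have h2 : 0 < expR (1 / 2) :> R := expR_gt0 _.
  have h3 : expR (- (1 / 2)) * expR (1 / 2) = 1 :> R by rewrite -expRD addNr expR0.
  have := ler_wpM2r (ltW h2) h1; rewrite h3; lra.
have -> : expR 1 = expR (1 / 2) * expR (1 / 2) :> R.
  by rewrite -expRD; congr expR; field.
have -> : 4 = 2 * 2 :> R by ring.
by rewrite ler_pM ?expR_ge0.
Qed.

Lemma cusum_mean_change (R : realType) n T (t tau : nat) (Ta Tb Pi : 'M[R]_n) :
  (0 < t < T)%N -> (0 < tau < T)%N ->
  cusum_mean (fun s : 'I_T => if (s < tau)%N then Ta else Tb) Pi t =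
  shift_weight R T t tau *: hadamard Pi (Ta - Tb).
Proof.
move=> tT tauT; rewrite /cusum_mean.
rewrite [LHS](_ : _ = cusum (fun s : 'I_T => if (s < tau)%N then hadamard Pi Ta
                                        else hadamard Pi Tb) t).
  rewrite cusum_shift //; congr (_ *: _); apply/matrixP => i j.
  by rewrite !mxE mulrBr.
by rewrite !cusumE; apply: eq_bigr => s _; case: ifP.
Qed.

Lemma cusum_mean_constant (R : realType) n T (t : nat) (Theta Pi : 'M[R]_n) :
  (0 < t < T)%N -> cusum_mean (fun _ : 'I_T => Theta) Pi t = 0.
Proof.
(* A constant sequence is viewed as a change between equal matrices. *)
move=> tT; have := @cusum_mean_change R n T t t Theta Theta Pi tT tT.
rewrite /cusum_mean => h; transitivity (shift_weight R T t t *: hadamard Pi (Theta - Theta)).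
  by rewrite -h !cusumE; apply: eq_bigr => s _; case: ifP.
by apply/matrixP => i j; rewrite !mxE subrr !mulr0.
Qed.

(** * The two error bounds *)

Section Levels.
Variables (R : realType) (n T : nat).
Hypotheses (n2 : (2 <= n)%N) (T2 : (2 <= T)%N).

Definition log_level (delta : R) : R := ln (4 * n%:R * log2 T%:R / delta).

Lemma log_level_arg_ge (delta : R) : 0 < delta -> delta < 1 ->
  4 <= 4 * n%:R * log2 T%:R / delta.
Proof.
move=> d0 d1; have l1 := log2_ge1 R T2; have n1 : 1 <= n%:R :> R by rewrite ler1n ltnW.
rewrite ler_pdivlMr //.
have : n%:R * 1 <= n%:R * log2 T%:R :> R by rewrite ler_wpM2l.
rewrite -mulrA; lra.
Qed.

Lemma log_level_ge1 delta : 0 < delta -> delta < 1 -> 1 <= log_level delta.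
Proof. by move=> d0 d1; apply: ln_ge1; exact: log_level_arg_ge. Qed.

Lemma log_level_tail delta : 0 < delta -> delta < 1 ->
  n%:R * expR (- log_level delta) = delta / (4 * log2 T%:R).
Proof.
move=> d0 d1; have l1 := log2_ge1 R T2; have n0 : 0 < n%:R :> R by rewrite ltr0n ltnW.
rewrite expRN lnK ?posrE; last by apply: lt_le_trans (log_level_arg_ge d0 d1).
by field; rewrite !gt_eqF //; lra.
Qed.

Lemma ler_log_level (d d' : R) : 0 < d -> d <= d' -> d' < 1 -> log_level d' <= log_level d.
Proof.
move=> d0 dd d1; have d'0 := lt_le_trans d0 dd.
rewrite ler_ln ?posrE; try by apply: lt_le_trans (log_level_arg_ge _ _) => //; lra.
apply: ler_wpM2l; last by rewrite lef_pV2.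
have l0 : 0 <= log2 T%:R :> R by apply: le_trans (log2_ge1 R T2).
by apply: mulr_ge0 l0; rewrite mulr_ge0.
Qed.

Variables (eps omega : R).
Hypotheses (eps0 : 0 < eps) (eps_le : eps <= 1 / 2) (omega0 : 0 < omega).

Lemma type1_error_le (alpha : R) : 0 < alpha < 1 ->
  type1_error omega (cusum_test (n := n) (T := T)
    (threshold eps (36 / eps) omega alpha n T)) <= alpha.
Proof.
move=> /andP[a0 a1]; have L1 := log_level_ge1 a0 a1.
apply: sup_le_nonneg => [|_ [[Th Pi] SnT <-]]; first exact: ltW.
rewrite /P0 /=; set H := threshold _ _ _ _ _ _.
(* The threshold is the deviation level of [cusum_tail] at [L = log_level alpha], and without a
   change the mean vanishes. *)
have HE : H = tail_level omega eps (log_level alpha) by [].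
have H0 : 0 <= H.
  have e1 : 0 <= 1 + eps by rewrite addr_ge0 // ltW.
  have L0 : 0 <= log_level alpha by lra.
  have h1 : 0 <= 36 / eps * log_level alpha by rewrite mulr_ge0 // divr_ge0 // ltW.
  have h2 : 0 <= 2 * Num.sqrt 2 * (1 + eps) * Num.sqrt omega.
    by rewrite mulr_ge0 ?sqrtr_ge0 // mulr_ge0 // mulr_ge0 // sqrtr_ge0.
  by rewrite HE addr_ge0.
have sn : forall s : 'I_T, Sn omega (Th, Pi) by [].
have pmf0 (w : sample n T) : 0 <= sample_pmf (fun _ : 'I_T => Th) Pi w.
  (* Time 1 serves as an instance: [0 < 1 < T] reduces to [T2]. *)
  exact: (prod_pmf_ge0 (coord_pmf_ge0 (t := 1%N) T2 sn) w).
apply: le_trans (IRGML_prob_has (s := dyadic_grid R T)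
  (F := fun t Y => H <= opnorm (cusum Y t - cusum_mean (fun _ : 'I_T => Th) Pi t)) pmf0 _) _.
  move=> Y; rewrite /cusum_test => HY; apply/hasP.
  have /hasP[t tg Ht] : has (fun t => H < opnorm (cusum Y t)) (dyadic_grid R T).
    apply: contraTT HY => /hasPn h; rewrite -leNgt.
    by rewrite big_seq; apply: bigmax_le => // t tg; rewrite leNgt h.
  have tT := dyadic_grid_itv T2 tg; exists t => //; rewrite cusum_mean_constant //.
  by rewrite subr0 ltW.
apply: (@le_trans _ _ (\sum_(t <- dyadic_grid R T) alpha / (4 * log2 T%:R))).
  rewrite big_seq [leRHS]big_seq; apply: ler_sum => t tg.
  rewrite -log_level_tail //.
  exact: (cusum_tail omega0 (dyadic_grid_itv T2 tg) sn eps0 eps_le L1).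
(* At most [2 * log2 T] grid points, each with probability at most [alpha / (4 * log2 T)], total at
   most [alpha / 2]. *)
rewrite big_const_seq count_predT iter_addr_0 -[leLHS]mulr_natr.
have l1 := log2_ge1 R T2; have l0 : 0 < 4 * log2 T%:R :> R by lra.
rewrite mulrAC ler_pdivrMr // ler_wpM2l ?(ltW a0) //.
by apply: le_trans (size_dyadic_grid R T2) _; lra.
Qed.

Lemma type2_error_le (alpha beta r : R) : 0 < alpha < 1 -> 0 < beta < 1 ->
  4 * (1 + eps) * Num.sqrt (6 * omega / T%:R)
    + 144 / eps / Num.sqrt T%:R * log_level (Num.min alpha beta) <= r ->
  type2_error omega r (cusum_test (n := n) (T := T)
    (threshold eps (36 / eps) omega alpha n T)) <= beta.
Proof.
move=> /andP[a0 a1] /andP[b0 b1] hr.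
set L := log_level (Num.min alpha beta) in hr.
have m0 : 0 < Num.min alpha beta by rewrite lt_min a0.
have ma : Num.min alpha beta <= alpha by rewrite ge_min lexx.
have mb : Num.min alpha beta <= beta by rewrite ge_min lexx orbT.
have m1 : Num.min alpha beta < 1 by apply: le_lt_trans ma a1.
have L1 : 1 <= L by exact: log_level_ge1.
have La : log_level alpha <= L by exact: ler_log_level.
apply: sup_le_nonneg => [|_ [tau tauT <-]]; first exact: ltW.
apply: sup_le_nonneg => [|_ [[[Ta Pi] [Tb Pi']] [/= Sa Sb e hW] <-]]; first exact: ltW.
subst Pi'; rewrite /Pchange /=; set H := threshold _ _ _ _ _ _.
set Theta := fun s : 'I_T => _.
have sn (s : 'I_T) : Sn omega (Theta s, Pi) by rewrite /Theta; case: ifP.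
have [t tg [w0 hw]] := shift_weight_grid R T2 tauT.
have tT := dyadic_grid_itv T2 tg.
have T0 : 0 < T%:R :> R by rewrite ltr0n ltnW.
set D := hadamard Pi (Ta - Tb) in hW.
have meanE : opnorm (cusum_mean Theta Pi t) = shift_weight R T t tau * opnorm D.
  by rewrite cusum_mean_change // opnormZ.
(* The mean must clear the threshold by a full deviation level, so that acceptance forces a
   deviation governed by [cusum_tail]. *)
have mean_ge : H + tail_level omega eps L <= opnorm (cusum_mean Theta Pi t).
  have h1 : Num.sqrt T%:R * r <= Num.sqrt 3 * opnorm (cusum_mean Theta Pi t).
    apply: (@le_trans _ _ (Num.sqrt T%:R * (q (tau%:R / T%:R) * opnorm D))).
      by rewrite ler_wpM2l ?sqrtr_ge0.
    by rewrite meanE !mulrA ler_wpM2r ?opnorm_ge0.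
  have h2 : 4 * (1 + eps) * (Num.sqrt 3 * (Num.sqrt 2 * Num.sqrt omega)) + 144 / eps * L
      <= Num.sqrt T%:R * r.
    have sT : 0 < Num.sqrt (T%:R : R) by rewrite sqrtr_gt0.
    apply: le_trans (ler_wpM2l (ltW sT) hr); rewrite le_eqVlt; apply/orP; left; apply/eqP.
    have -> : Num.sqrt (6 * omega / T%:R) =
        Num.sqrt 3 * (Num.sqrt 2 * Num.sqrt omega) / Num.sqrt T%:R.
      rewrite -!sqrtrM // -sqrtrV ?ltW // -sqrtrM ?mulr_ge0 ?(ltW omega0) //.
      by congr (Num.sqrt (_ / _)); ring.
    by field; rewrite !gt_eqF.
  have s30 : 0 < Num.sqrt 3 :> R by rewrite sqrtr_gt0.
  have s32 : Num.sqrt 3 <= 2 :> R.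
    rewrite -[leRHS]ger0_norm // -sqrtr_sqr ler_wsqrtr //; lra.
  rewrite -(ler_pM2l s30); apply: le_trans (le_trans h2 h1).
  rewrite /H /threshold /tail_level -/(log_level alpha).
  set A := Num.sqrt 3 in s30 s32 *.
  set B := 2 * Num.sqrt 2 * (1 + eps) * Num.sqrt omega.
  have -> : 4 * (1 + eps) * (A * (Num.sqrt 2 * Num.sqrt omega)) = A * (2 * B).
    by rewrite /B; ring.
  have e36 : 0 < 36 / eps by rewrite divr_gt0.
  have h3 : 36 / eps * log_level alpha <= 36 / eps * L by rewrite ler_pM2l.
  have eL0 : 0 <= 36 / eps * L by rewrite mulr_ge0 ?ltW //; lra.
  (* The [omega] terms match exactly, the [Num.sqrt 3] being part of the [Num.sqrt 6]; in the
     logarithmic term [Num.sqrt 3] is rounded up to 2, whence [144 = 2 * 2 * 36]. *)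
  have h4 : A * (2 * (36 / eps * L)) <= 2 * (2 * (36 / eps * L)).
    by rewrite ler_wpM2r // mulr_ge0.
  have -> : 144 / eps * L = 2 * (2 * (36 / eps * L)) by ring.
  apply: le_trans (lerD (lexx _) h4); rewrite -mulrDr ler_pM2l //; lra.
have pmf0 (w : sample n T) : 0 <= sample_pmf Theta Pi w.
  exact: (prod_pmf_ge0 (coord_pmf_ge0 tT sn) w).
(* A single grid point suffices for the power; the one-element list turns the union bound into
   monotonicity. *)
apply: le_trans (IRGML_prob_has (s := [:: t]) (F := fun t Y =>
  tail_level omega eps L <= opnorm (cusum Y t - cusum_mean Theta Pi t)) pmf0 _) _.
  move=> Y; rewrite /cusum_test -leNgt /= orbF => HY.
  have Ht : opnorm (cusum Y t) <= H.
    apply: le_trans HY.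
    by apply: (@le_bigmax_seq _ _ _ _ _ t xpredT (fun t => opnorm (cusum Y t)) tg).
  have tri : opnorm (cusum_mean Theta Pi t) <=
      opnorm (cusum Y t) + opnorm (cusum Y t - cusum_mean Theta Pi t).
    rewrite -{1}(subKr (cusum Y t) (cusum_mean Theta Pi t)).
    apply: le_trans (opnormD _ _) _; rewrite lerD2l -scaleN1r.
    by apply: le_trans (opnormZ_le _ _) _; rewrite normrN1 mul1r.
  lra.
rewrite big_seq1; apply: le_trans (cusum_tail omega0 tT sn eps0 eps_le L1) _.
rewrite log_level_tail //; have l1 := log2_ge1 R T2.
apply: le_trans mb; rewrite ler_pdivrMr; last by lra.
by rewrite ler_peMr ?(ltW m0) //; lra.
Qed.

End Levels.

Theorem theorem3 (R : realType) (eps : R) (eps_gt0 : 0 < eps)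
    (eps_le : eps <= 1 / 2) :
  exists Ceps C : R, [/\ 0 < Ceps, 0 < C &
    forall (n T : nat) (omega alpha beta r : R),
      (2 <= n)%N -> (2 <= T)%N -> 0 < omega ->
      0 < alpha < 1 -> 0 < beta < 1 ->
      4 * (1 + eps) * Num.sqrt (6 * omega / T%:R)
        + C / Num.sqrt T%:R * ln (4 * n%:R * log2 T%:R / Num.min alpha beta)
        <= r ->
      let psi := cusum_test (n := n) (T := T)
                   (threshold eps Ceps omega alpha n T) in
      type1_error omega psi <= alpha /\ type2_error omega r psi <= beta].
Proof.
exists (36 / eps), (144 / eps); split; [exact: divr_gt0 | exact: divr_gt0 |].
move=> n T omega alpha beta r n2 T2 omega0 a01 b01 hr; split.
  exact: type1_error_le.
exact: type2_error_le hr.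
Qed.
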